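(* For all but finitely many pairs of integers $(d,n)$ with $3\leq d\leq \frac{n}{2}$, neither the open Grassmannian $\mathrm{Gr}^{\circ}(d,n;\mathbb{C})$ nor the moduli space $\mathcal{R}(d,n)$ is schön.
   Context: $\mathrm{Gr}^{\circ}(d,n;\mathbb{C})$ is the open subvariety of the Grassmannian $\mathrm{Gr}(d,n;\mathbb{C})\subset\mathbb{P}^{\binom{n}{d}-1}$ (Plücker embedding) on which all Plücker coordinates $p_\lambda$, $\lambda\in\binom{[n]}{d}$, are nonzero. It is a closed subvariety of the algebraic torus $(\mathbb{C}^* )^{\binom{n}{d}}/\mathbb{C}^*$, whose character lattice is $\{u\in\mathbb{Z}^{\binom{[n]}{d}}:\sum_\lambda u_\lambda=0\}$. The torus $T=(\mathbb{C}^* )^n/\mathbb{C}^*$ acts freely on $\mathrm{Gr}^{\circ}(d,n;\mathbb{C})$ by scaling the coordinates of $\mathbb{C}^n$ (so $t$ scales $p_\lambda$ by $\prod_{i\in\lambda}t_i$). $\mathcal{R}(d,n)=\mathrm{Gr}^{\circ}(d,n;\mathbb{C})/T$ is the moduli space of $n$ hyperplanes in $\mathbb{P}^{d-1}_{\mathbb{C}}$ in linear general position up to $\mathrm{PGL}_d(\mathbb{C})$. It is a closed subvariety of the quotient torus, whose character lattice is $\{u\in\mathbb{Z}^{\binom{[n]}{d}}:\sum_\lambda u_\lambda\sum_{i\in\lambda}\epsilon_i=0 \text{ in } \mathbb{Z}^n\}$, where $\epsilon_1,\dots,\epsilon_n$ is the standard basis of $\mathbb{Z}^n$. Let $X=V(I)$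 be a closed subvariety of an algebraic torus $\mathrm{Spec}\,\mathbb{C}[M]$ with $M$ a lattice, and let $w\in\mathrm{Hom}(M,\mathbb{R})$. For $f=\sum c_u x^u$ with all $c_u\neq0$, $\mathrm{in}_w f$ is the sum of the terms $c_ux^u$ for which $\langle u,w\rangle$ is minimal. Set $\mathrm{in}_wI=\langle \mathrm{in}_wf:f\in I\rangle$ and let $\mathrm{in}_wX=V(\mathrm{in}_wI)$, the initial degeneration, regarded as a scheme. $X$ is schön if $\mathrm{in}_wX$ is smooth for all $w$. *)

(* Defs.v *)
From HB Require Import structures.
From mathcomp Require Import all_boot all_order all_algebra.
From mathcomp Require Import ring_quotient finmap complex.
From mathcomp Require Import boolp classical_sets reals.
From mathcomp Require Import monalg.

Set Implicit Arguments.
Unset Strict Implicit.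
Unset Printing Implicit Defensive.

Import Order.TTheory GRing.Theory Num.Theory.

Local Open Scope ring_scope.
Local Open Scope quotient_scope.
Local Open Scope classical_set_scope.

(* The group algebra k[M] of an abelian group M (written additively): finitely
   supported functions M -> k with the convolution product, << c *g u >> being
   the monomial c x^u.  The library only puts a ring structure on {malg k[M]}
   for monoids M without nontrivial units, hence the alias. *)
Definition grpalg (k : comNzRingType) (M : zmodType) := {malg k[M]}.

HB.instance Definition _ (k : comNzRingType) (M : zmodType) :=
  GRing.Lmodule.on (grpalg k M).

Section GroupAlgebra.
Variables (k : comNzRingType) (M : zmodType).
Implicit Types f g h : {malg k[M]}.

Definition ga_mul f g : {malg k[M]} :=
  \sum_(u <- msupp f) \sum_(v <- msupp g) << f@_u * g@_v *g u + v >>.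

Lemma ga_mulw (d1 d2 : {fset M}) f g :
  (msupp f `<=` d1)%fset -> (msupp g `<=` d2)%fset ->
  ga_mul f g = \sum_(u <- d1) \sum_(v <- d2) << f@_u * g@_v *g u + v >>.
Proof.
move=> le_d1 le_d2; rewrite /ga_mul (big_fset_incl _ le_d1) /=.
  apply/eq_bigr=> u _; apply/big_fset_incl => // v _ /mcoeff_outdom ->.
  by rewrite mulr0 monalgU0.
move=> u _ /mcoeff_outdom fu.
by rewrite big1 => // v _; rewrite fu mul0r monalgU0.
Qed.

Lemma ga_mulC : commutative ga_mul.
Proof.
move=> f g; rewrite /ga_mul exchange_big; apply/eq_bigr => u _.
by apply/eq_bigr => v _; rewrite mulrC addrC.
Qed.

Lemma ga_mulDl : left_distributive ga_mul +%R.
Proof.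
move=> f g h.
rewrite (@ga_mulw (msupp f `|` msupp g)%fset (msupp h) (f + g)) ?msuppD_le //.
rewrite (@ga_mulw (msupp f `|` msupp g)%fset (msupp h) f) ?fsubsetUl //.
rewrite (@ga_mulw (msupp f `|` msupp g)%fset (msupp h) g) ?fsubsetUr //.
rewrite -big_split /=; apply/eq_bigr=> u _.
rewrite -big_split /=; apply/eq_bigr=> v _.
by rewrite mcoeffD mulrDl monalgUD.
Qed.

Lemma ga_mulDr : right_distributive ga_mul +%R.
Proof. by move=> f g h; rewrite ga_mulC ga_mulDl !(ga_mulC f). Qed.

Lemma ga_mul0l f : ga_mul 0 f = 0.
Proof. by rewrite /ga_mul msupp0 big_seq_fset0. Qed.

Lemma ga_mul0r f : ga_mul f 0 = 0.
Proof. by rewrite ga_mulC ga_mul0l. Qed.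

Lemma ga_mulUU a b u v :
  ga_mul << a *g u >> << b *g v >> = << a * b *g u + v >>.
Proof. by rewrite (ga_mulw msuppU_le msuppU_le) !big_seq_fset1 !mcoeffUU. Qed.

Lemma ga_mul_suml (I : Type) (r : seq I) (F : I -> {malg k[M]}) g :
  ga_mul (\sum_(i <- r) F i) g = \sum_(i <- r) ga_mul (F i) g.
Proof. exact: (big_morph (ga_mul^~ g) (fun _ _ => ga_mulDl _ _ _) (ga_mul0l g)). Qed.

Lemma ga_mul_sumr (I : Type) (r : seq I) (F : I -> {malg k[M]}) g :
  ga_mul g (\sum_(i <- r) F i) = \sum_(i <- r) ga_mul g (F i).
Proof. exact: (big_morph (ga_mul g) (fun _ _ => ga_mulDr _ _ _) (ga_mul0r g)). Qed.

Lemma ga_mulA : associative ga_mul.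
Proof.
move=> f g h; rewrite (monalgE f) (monalgE g) (monalgE h).
rewrite [LHS]ga_mul_suml [X in _ = ga_mul X _]ga_mul_suml [RHS]ga_mul_suml.
apply/eq_bigr => u _.
rewrite [X in ga_mul _ X = _]ga_mul_suml [LHS]ga_mul_sumr.
rewrite [X in _ = ga_mul X _]ga_mul_sumr [RHS]ga_mul_suml.
apply/eq_bigr => v _.
rewrite !ga_mul_sumr; apply/eq_bigr => t _.
by rewrite !ga_mulUU mulrA addrA.
Qed.

Definition ga_one : {malg k[M]} := << 1 *g 0 >>.

Lemma ga_mul1l : left_id ga_one ga_mul.
Proof.
move=> f; rewrite [in LHS](monalgE f) ga_mul_sumr [RHS]monalgE.
by apply/eq_bigr => u _; rewrite ga_mulUU mul1r add0r.
Qed.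

Lemma ga_one_neq0 : ga_one != 0.
Proof. by rewrite monalgU_eq0 oner_eq0. Qed.

HB.instance Definition _ := GRing.Zmodule_isComNzRing.Build (grpalg k M)
  ga_mulA ga_mulC ga_mul1l ga_mulDl ga_one_neq0.

Lemma ga_scaleAl a f g : a *: ga_mul f g = ga_mul (a *: f) g.
Proof.
have scaleE (c b : k) (u : M) : c *: << b *g u >> = << c * b *g u >>.
  by apply/malgP => v; rewrite mcoeffZ !mcoeffU mulrnAr.
rewrite (monalgE f) [in RHS]scaler_sumr !ga_mul_suml scaler_sumr.
apply/eq_bigr => u _; rewrite (monalgE g) scaleE !ga_mul_sumr scaler_sumr.
by apply/eq_bigr => v _; rewrite !ga_mulUU scaleE mulrA.
Qed.

HB.instance Definition _ := GRing.Lmodule_isLalgebra.Build k (grpalg k M)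
  ga_scaleAl.
HB.instance Definition _ := GRing.Lalgebra_isComAlgebra.Build k (grpalg k M).

End GroupAlgebra.

Definition initial_form (R : realType) (k : comNzRingType) (M : zmodType)
    (w : {additive M -> R}) (f : grpalg k M) : grpalg k M :=
  \sum_(u <- msupp f | all (fun v => w u <= w v) (msupp f)) << f@_u *g u >>.

(* The value of f at the point x of the torus Hom(M, k^* ) = Spec k[M] (k). *)
Definition torus_eval (k : comNzRingType) (M : zmodType) (x : M -> k)
    (f : grpalg k M) : k :=
  \sum_(u <- msupp f) f@_u * x u.

(* The ideal of the Zariski closure of X, with its reduced structure. *)
Definition vanishing_ideal (k : comNzRingType) (M : zmodType)
    (X : set (M -> k)) : set (grpalg k M) :=
  [set f | forall x, X x -> torus_eval x f = 0].

(* The ideal <S> and the quotient A / <S>.  The ideal may be the unit ideal, so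
   that A / <S> may be the zero ring (and V(S) the empty scheme). *)
Section IdealQuotient.
Variables (A : comPzRingType) (S : set A).

Definition ideal_span : {pred A} := fun f =>
  `[< exists s : seq (A * A),
        {in s, forall p, S p.2} /\ f = \sum_(p <- s) p.1 * p.2 >].

Lemma ideal_spanMl a f : f \in ideal_span -> a * f \in ideal_span.
Proof.
move=> /asboolP[s [sS ->]]; apply/asboolP.
exists [seq (a * p.1, p.2) | p <- s]; split.
  by move=> _ /mapP[p /sS Sp ->].
by rewrite big_map mulr_sumr; apply/eq_bigr => p _; rewrite mulrA.
Qed.

Lemma ideal_span_zmod : zmod_closed ideal_span.
Proof.
split.
  by apply/asboolP; exists [::]; rewrite big_nil.
move=> f g fI /(ideal_spanMl (-1)); rewrite mulN1r.
move: fI => /asboolP[s [sS ->]] /asboolP[t [tS ->]]; apply/asboolP.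
exists (s ++ t); split; last by rewrite big_cat.
by move=> p; rewrite mem_cat => /orP[/sS|/tS].
Qed.

HB.instance Definition _ := GRing.isZmodClosed.Build A ideal_span
  ideal_span_zmod.

Definition quot_ring := Quotient.quot ideal_span.

HB.instance Definition _ := GRing.Zmodule.on quot_ring.

Definition quot_pi (a : A) : quot_ring := \pi_quot_ring a.

Lemma quot_pi_eq a b : quot_pi a = quot_pi b <-> a - b \in ideal_span.
Proof. by rewrite Quotient.idealrBE; split=> [/eqP|/eqP]. Qed.

Definition quot_one := quot_pi 1.
Definition quot_mul (x y : quot_ring) := quot_pi (repr x * repr y).

Lemma quot_piM a b : quot_pi (a * b) = quot_mul (quot_pi a) (quot_pi b).
Proof.
pose a' := repr (quot_pi a); pose b' := repr (quot_pi b).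
apply/quot_pi_eq; rewrite -/a' -/b'.
have aI : a - a' \in ideal_span by apply/quot_pi_eq; rewrite /quot_pi reprK.
have bI : b - b' \in ideal_span by apply/quot_pi_eq; rewrite /quot_pi reprK.
have -> : a * b - a' * b' = b * (a - a') + a' * (b - b').
  by rewrite !mulrBr addrA (mulrC b a) (mulrC b a') subrK.
by rewrite rpredD ?ideal_spanMl.
Qed.

Lemma quot_piP (x : quot_ring) : exists a, x = quot_pi a.
Proof. by exists (repr x); rewrite /quot_pi reprK. Qed.

Fact quot_mulA : associative quot_mul.
Proof.
move=> x y z; have [a ->] := quot_piP x; have [b ->] := quot_piP y; have [c ->] := quot_piP z.
by rewrite -!quot_piM mulrA.
Qed.

Fact quot_mulC : commutative quot_mul.
Proof.
move=> x y; have [a ->] := quot_piP x; have [b ->] := quot_piP y.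
by rewrite -!quot_piM mulrC.
Qed.

Fact quot_mul1l : left_id quot_one quot_mul.
Proof. by move=> x; have [a ->] := quot_piP x; rewrite -quot_piM mul1r. Qed.

Lemma quot_pi_is_zmod_morphism : zmod_morphism quot_pi.
Proof. by move=> a b; rewrite /quot_pi raddfB. Qed.

Fact quot_mulDl : left_distributive quot_mul +%R.
Proof.
have piD a b : quot_pi a + quot_pi b = quot_pi (a + b) by rewrite /quot_pi raddfD.
move=> x y z; have [a ->] := quot_piP x; have [b ->] := quot_piP y; have [c ->] := quot_piP z.
by rewrite piD -!quot_piM piD mulrDl.
Qed.

HB.instance Definition _ := GRing.Zmodule_isComPzRing.Build quot_ring
  quot_mulA quot_mulC quot_mul1l quot_mulDl.

HB.instance Definition _ := GRing.isZmodMorphism.Build A quot_ring quot_pi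
  quot_pi_is_zmod_morphism.
HB.instance Definition _ := GRing.isMonoidMorphism.Build A quot_ring quot_pi
  (erefl, quot_piM).

End IdealQuotient.

(* Smoothness of a ring map phi : k -> A, i.e. of the morphism of affine schemes
   Spec A -> Spec k, in the sense of EGA IV, 17.3.1: phi is of finite
   presentation and formally smooth. *)
Section Smooth.
Variables (k : comNzRingType) (A : comPzRingType) (phi : {rmorphism k -> A}).

Definition finitely_presented : Prop :=
  exists (n : nat) (pi : {rmorphism {mpoly k[n]} -> A}),
    [/\ forall c, pi c%:MP = phi c,
        forall a, exists p, pi p = a &
        exists s : seq {mpoly k[n]},
          forall p, pi p = 0 <-> p \in ideal_span [set` s]].

(* Every k-morphism A -> C lifts through every surjection of k-algebras
   q : B -> C whose kernel has square zero. *)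
Definition formally_smooth : Prop :=
  forall (B C : comPzRingType) (beta : {rmorphism k -> B})
      (q : {rmorphism B -> C}) (g : {rmorphism A -> C}),
    (forall c, exists b, q b = c) ->
    (forall b b', q b = 0 -> q b' = 0 -> b * b' = 0) ->
    (forall c, g (phi c) = q (beta c)) ->
  exists h : {rmorphism A -> B},
    (forall c, h (phi c) = beta c) /\ (forall a, q (h a) = g a).

Definition smooth : Prop := finitely_presented /\ formally_smooth.

End Smooth.

(* V(I) is a closed subscheme of the torus Spec C[M], where C = R[i]. *)
Section Schon.
Variables (R : realType) (M : zmodType) (I : set (grpalg R[i] M)).

(* The generators of in_w I; the ideal itself is their ideal_span. *)
Definition initial_forms (w : {additive M -> R}) : set (grpalg R[i] M) :=
  [set initial_form w f | f in I].

(* The coordinate ring C[M] / in_w I of the initial degeneration in_w V(I), and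
   its structure map. *)
Definition initial_degeneration (w : {additive M -> R}) : comPzRingType :=
  quot_ring (initial_forms w).

Definition initial_degeneration_map (w : {additive M -> R}) :
    {rmorphism R[i] -> initial_degeneration w} :=
  quot_pi (initial_forms w) \o in_alg (grpalg R[i] M).

Definition schon : Prop :=
  forall w : {additive M -> R}, smooth (initial_degeneration_map w).

End Schon.

Section Kernel.
Variables (U V : zmodType) (phi : {additive U -> V}).

Definition in_kernel : {pred U} := fun u => phi u == 0.

Fact in_kernel_zmod : zmod_closed in_kernel.
Proof.
by split=> [|u v]; rewrite !unfold_in ?raddf0 // raddfB => /eqP-> /eqP->; rewrite subrr.
Qed.

HB.instance Definition _ := GRing.isZmodClosed.Build U in_kernel in_kernel_zmod.

Record kernel := Kernel { kernel_val : U; _ : kernel_val \in in_kernel }.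

HB.instance Definition _ := [isSub for kernel_val].
HB.instance Definition _ := [Choice of kernel by <:].
HB.instance Definition _ := [SubChoice_isSubZmodule of kernel by <:].

End Kernel.

Section OpenGrassmannian.
Variables (R : realType) (d n : nat).

Definition dset := {l : {set 'I_n} | #|l| == d}.

(* The j-th smallest element of l. *)
Definition dset_nth (l : dset) (j : 'I_d) : 'I_n :=
  enum_val (cast_ord (esym (eqP (valP l))) j).

Definition pluecker (A : 'M[R[i]]_(d, n)) : {ffun dset -> R[i]} :=
  [ffun l => \det (colsub (dset_nth l) A)].

(* The affine cone over Gr^o(d, n): the Pluecker vectors, none of whose
   coordinates vanishes, of the d-dimensional subspaces of C^n (row spaces). *)
Definition open_grassmannian : set {ffun dset -> R[i]} :=
  [set p | (exists A : 'M[R[i]]_(d, n), row_free A /\ p = pluecker A) /\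
           forall l, p l != 0].

(* For a sublattice M = ker phi of Z^(dset), the image of p under the quotient
   (C^* )^(dset) -> Hom(M, C^* ) of tori dual to M -> Z^(dset). *)
Definition torus_point (V : zmodType) (phi : {additive {ffun dset -> int} -> V})
    (p : {ffun dset -> R[i]}) : kernel phi -> R[i] :=
  fun u => \prod_(l : dset) p l ^ (val u l).
Arguments torus_point {V} phi p u.

Definition total_degree (u : {ffun dset -> int}) : int := \sum_(l : dset) u l.

Definition std_basis (i : 'I_n) : {ffun 'I_n -> int} := [ffun j => (i == j)%:R].

Definition multidegree (u : {ffun dset -> int}) : {ffun 'I_n -> int} :=
  \sum_(l : dset) (\sum_(i in val l) std_basis i) *~ u l.

Fact total_degree_is_zmod_morphism : zmod_morphism total_degree.
Proof.
by move=> u v; rewrite /total_degree -sumrB; apply: eq_bigr => l _; rewrite !ffunE.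
Qed.

Fact multidegree_is_zmod_morphism : zmod_morphism multidegree.
Proof.
move=> u v; rewrite /multidegree -sumrB; apply: eq_bigr => l _.
by rewrite !ffunE mulrzBr.
Qed.

HB.instance Definition _ := GRing.isZmodMorphism.Build _ _ total_degree
  total_degree_is_zmod_morphism.
HB.instance Definition _ := GRing.isZmodMorphism.Build _ _ multidegree
  multidegree_is_zmod_morphism.

(* ker total_degree is the character lattice of (C^* )^(dset) / C^*, and
   ker multidegree that of its quotient by T = (C^* )^n / C^*; the points of
   R(d, n) = Gr^o(d, n) / T are thus the images of those of Gr^o(d, n). *)
Definition open_grassmannian_ideal : set (grpalg R[i] (kernel total_degree)) :=
  vanishing_ideal (torus_point total_degree @` open_grassmannian).

Definition moduli_hyperplanes_ideal : set (grpalg R[i] (kernel multidegree)) :=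
  vanishing_ideal (torus_point multidegree @` open_grassmannian).

End OpenGrassmannian.

Arguments open_grassmannian_ideal R d n : clear implicits.
Arguments moduli_hyperplanes_ideal R d n : clear implicits.

(* Main.v *)
Require Import Defs.
From HB Require Import structures.
From mathcomp Require Import all_boot all_order all_algebra.
From mathcomp Require Import finmap complex.
From mathcomp Require Import boolp classical_sets reals.
From mathcomp Require Import monalg ring perm zify.

Set Implicit Arguments.
Unset Strict Implicit.
Unset Printing Implicit Defensive.

Import Order.TTheory GRing.Theory Num.Theory.

Local Open Scope ring_scope.

(** If the ideal of a closed subvariety of a torus is schoen, its initial degenerations are
    formally smooth, so that each of their points over the dual numbers C[e]/(e^2) lifts to
    C[e]/(e^3). The theorem holds because realization spaces of matroids of rank 3 can be
    singular, and because they appear in initial degenerations: the proof exhibits a point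
    over the dual numbers that does not lift. The open Grassmannian and the moduli space are
    treated together, as they only differ by the map [phi] whose kernel is the character
    lattice; all the characters evaluated below are invariant under the larger torus.

    Points of an initial degeneration come from matrices over (C[e]/(e^2))[t] whose maximal
    minors are powers of t times a unit plus higher terms: the exponents give w, and the
    leading coefficients are the Pluecker coordinates of a point of the degeneration
    ([degeneration_point]). A constant matrix all of whose minors, of all sizes, are zero or
    units can be perturbed into such a matrix ([perturbation]). So a realization of a matroid
    over the dual numbers gives a point of an initial degeneration, for a w that vanishes
    exactly at the bases.

    Conversely, a point of that degeneration over any ring gives a realization of the matroid.
    The coordinates of the points of a planar configuration, normalized by four of them in
    general position, are Laurent monomials in the Pluecker coordinates. The determinant of
    three points in normalized coordinates is a monomial times their bracket
    ([frame_relation]), a relation in the ideal. If the three points are collinear the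
    bracket has positive weight, and the initial form of the relation says that the
    determinant vanishes ([initial_relation], [schon_realization_lift]). In rank d = 3 + r one
    uses the cone over the planar configuration, whose r apexes are contracted
    ([contraction]).

    It remains to find a planar configuration over the dual numbers that does not lift. In the
    one used here, of 16 points, collinearities force two quantities q and s to be roots of
    the same quadratic polynomial x^2 - (a + m) x + m, so that (q - s) (q + s - a - m) = 0.
    Where the polynomial has a double root both factors vanish: there, to first order, q can
    move away from s while a and m stay fixed, but not to second order ([two_roots],
    [jet_not_zero], [config_no_jet_lift]). The numerical values are chosen such that every
    determinant of three points is zero or a unit of the dual numbers. The 16 points and
    d - 3 apexes fit into n columns as soon as n >= 26, which leaves finitely many pairs with
    d <= n / 2. *)

(** * Quotient rings, group algebras and Laurent monomials *)

Section QuotientLift.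
Variables (A T : comPzRingType) (X : set A) (f : {rmorphism A -> T}).
Hypothesis fX : forall a, X a -> f a = 0.

(** The vanishing of f' on X is an argument, so that the morphism structures below can
    be attached to the function. *)
Definition quot_lift_along (f' : A -> T) (_ : forall a, X a -> f' a = 0)
    (x : quot_ring X) : T := f' (repr x).
Local Notation quot_lift := (quot_lift_along fX).

Lemma ideal_span_ker a : a \in ideal_span X -> f a = 0.
Proof.
move=> /asboolP[s [sX ->]]; rewrite rmorph_sum big_seq big1 // => p ps.
by rewrite rmorphM (fX (sX p ps)) mulr0.
Qed.

Lemma quot_lift_pi a : quot_lift (quot_pi X a) = f a.
Proof.
apply/eqP; rewrite -subr_eq0 -rmorphB; apply/eqP/ideal_span_ker.
by apply/quot_pi_eq; rewrite /quot_pi reprK.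
Qed.

Lemma quot_lift_is_zmod_morphism : zmod_morphism quot_lift.
Proof.
move=> x y; have [a ->] := quot_piP x; have [b ->] := quot_piP y.
by rewrite -rmorphB !quot_lift_pi rmorphB.
Qed.

Lemma quot_lift_is_monoid_morphism : monoid_morphism quot_lift.
Proof.
split; first by rewrite -(rmorph1 (quot_pi X)) quot_lift_pi rmorph1.
move=> x y; have [a ->] := quot_piP x; have [b ->] := quot_piP y.
by rewrite -rmorphM !quot_lift_pi rmorphM.
Qed.

HB.instance Definition _ :=
  GRing.isZmodMorphism.Build _ _ quot_lift quot_lift_is_zmod_morphism.
HB.instance Definition _ :=
  GRing.isMonoidMorphism.Build _ _ quot_lift quot_lift_is_monoid_morphism.

Lemma quot_ring_lift :
  exists g : {rmorphism quot_ring X -> T}, forall a, g (quot_pi X a) = f a.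
Proof. by exists quot_lift; apply: quot_lift_pi. Qed.

End QuotientLift.

Section GroupAlgebraEvaluation.
Variables (k : comNzRingType) (M : zmodType) (T : comPzRingType).
Variables (iota : {rmorphism k -> T}) (chi : M -> T).
Implicit Types f g : grpalg k M.

(** When chi is a character of M, this is the ring morphism extending iota and chi;
    [torus_eval] is the case where iota is the identity. *)
Definition ga_eval f : T := \sum_(u <- msupp f) iota f@_u * chi u.

Lemma ga_evalw (D : {fset M}) f : (msupp f `<=` D)%fset ->
  ga_eval f = \sum_(u <- D) iota f@_u * chi u.
Proof.
move=> fD; apply: big_fset_incl => // u _ /mcoeff_outdom ->.
by rewrite rmorph0 mul0r.
Qed.

Lemma ga_eval_is_zmod_morphism : zmod_morphism ga_eval.
Proof.
move=> f g; pose D := (msupp f `|` msupp g)%fset.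
rewrite (ga_evalw (fsubsetUl (msupp f) (msupp g))).
rewrite (ga_evalw (fsubsetUr (msupp f) (msupp g))).
rewrite (ga_evalw (msuppB_le f g)) -sumrB.
by apply: eq_bigr => u _; rewrite mcoeffB rmorphB mulrBl.
Qed.

HB.instance Definition _ :=
  GRing.isZmodMorphism.Build (grpalg k M) T ga_eval ga_eval_is_zmod_morphism.

Lemma ga_evalU c u : ga_eval << c *g u >> = iota c * chi u.
Proof. by rewrite (ga_evalw msuppU_le) big_seq_fset1 mcoeffUU. Qed.

Hypothesis chi0 : chi 0 = 1.
Hypothesis chiD : {morph chi : u v / u + v >-> u * v}.

Lemma ga_eval_is_monoid_morphism : monoid_morphism ga_eval.
Proof.
split; first by rewrite [1]/(<< 1 *g 0 >> : grpalg k M) ga_evalU rmorph1 mul1r.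
move=> f g; rewrite [f * g]/(ga_mul f g) /ga_mul raddf_sum mulr_suml.
apply: eq_bigr => u _; rewrite raddf_sum mulr_sumr; apply: eq_bigr => v _.
by rewrite /= ga_evalU rmorphM chiD mulrACA.
Qed.

End GroupAlgebraEvaluation.

Section IntegerPowers.
Variable (T : comPzRingType).

(** Integer powers of c, for an inverse c' given as data: the rings in use carry no
    inversion. *)
Definition zpow (c c' : T) (z : int) : T :=
  match z with Posz n => c ^+ n | Negz n => c' ^+ n.+1 end.

Section Inverse.
Variables (c c' : T).
Hypothesis cc' : c * c' = 1.

Lemma zpowB (m n : nat) : zpow c c' (m%:Z - n%:Z) = c ^+ m * c' ^+ n.
Proof.
have cc'X k : c ^+ k * c' ^+ k = 1 by rewrite -exprMn cc' expr1n.
have [/subnK <-|/ltnW /subnK <-] := leqP n m.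
  by rewrite PoszD addrK exprD -mulrA cc'X mulr1.
rewrite PoszD opprD addrCA subrr addr0 exprD mulrCA cc'X mulr1.
by case: (n - m)%N.
Qed.

Lemma zpowD : {morph zpow c c' : y z / y + z >-> y * z}.
Proof.
have zE z : exists m n : nat, z = m%:Z - n%:Z.
  by case: z => n; [exists n, 0%N; rewrite subr0 | exists 0%N, n.+1; rewrite sub0r NegzE].
move=> y z; have [m [n ->]] := zE y; have [m' [n' ->]] := zE z.
by rewrite addrACA -opprD -!PoszD !zpowB !exprD mulrACA.
Qed.

(** Clears the denominators of a Laurent monomial at the cost of c ^+ N, a factor that
    is the same for all the terms of a relation. *)
Lemma zpow_shift (N : nat) z : 0 <= N%:Z + z -> c ^+ absz (N%:Z + z) = c ^+ N * zpow c c' z.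
Proof.
by move=> Nz; rewrite -[c ^+ N]/(zpow c c' N) -zpowD; case: (N%:Z + z) Nz.
Qed.
End Inverse.

Variable (L : finType).

Definition monomial (c c' : L -> T) (u : {ffun L -> int}) : T :=
  \prod_l zpow (c l) (c' l) (u l).

Variables (c c' : L -> T).
Hypothesis cc' : forall l, c l * c' l = 1.

Lemma monomial0 : monomial c c' 0 = 1.
Proof. by rewrite /monomial big1 // => l _; rewrite ffunE. Qed.

Lemma monomialD : {morph monomial c c' : u v / u + v >-> u * v}.
Proof.
by move=> u v; rewrite /monomial -big_split; apply: eq_bigr => l _; rewrite ffunE zpowD.
Qed.

Definition unit_exponent (l : L) : {ffun L -> int} := [ffun l' => (l' == l)%:R].

Lemma monomial_unit_exponent l : monomial c c' (unit_exponent l) = c l.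
Proof.
rewrite /monomial (bigD1 l) //= ffunE eqxx big1 ?mulr1 // => l' /negPf l'l.
by rewrite ffunE l'l.
Qed.

End IntegerPowers.

Lemma zpow_exprz (F : fieldType) (x : F) z : zpow x x^-1 z = x ^ z.
Proof. by case: z => // n; rewrite /zpow exprVn. Qed.

(** * Truncated polynomials and polynomial identities *)

Section TruncatedPolynomials.
Variable k : comNzRingType.

(** The ring k[e]/(e^2), a + b e being the pair (a, b). *)
Definition dual := (k * k)%type.
HB.instance Definition _ := GRing.Zmodule.on dual.

Definition dual_mul (x y : dual) : dual := (x.1 * y.1, x.1 * y.2 + x.2 * y.1).

Fact dual_mulA : associative dual_mul.
Proof. by move=> x y z; rewrite /dual_mul /=; congr pair; ring. Qed.
Fact dual_mulC : commutative dual_mul.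
Proof. by move=> x y; rewrite /dual_mul /=; congr pair; ring. Qed.
Fact dual_mul1 : left_id ((1, 0) : dual) dual_mul.
Proof. by case=> x y; rewrite /dual_mul /=; congr pair; ring. Qed.
Fact dual_mulDl : left_distributive dual_mul +%R.
Proof. by move=> x y z; rewrite /dual_mul /=; congr pair => /=; ring. Qed.
Fact dual_1_neq0 : ((1, 0) : dual) != 0.
Proof. by rewrite -pair_eqE /= oner_eq0. Qed.
HB.instance Definition _ := GRing.Zmodule_isComNzRing.Build dual
  dual_mulA dual_mulC dual_mul1 dual_mulDl dual_1_neq0.

(** The ring k[e]/(e^3), a + b e + c e^2 being the triple (a, b, c); [jet_dual] is the
    reduction modulo e^2, the square-zero extension to which formal smoothness is
    applied. *)
Definition jet := (k * k * k)%type.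
HB.instance Definition _ := GRing.Zmodule.on jet.

Definition jet_mul (x y : jet) : jet :=
  (x.1.1 * y.1.1, x.1.1 * y.1.2 + x.1.2 * y.1.1,
   x.1.1 * y.2 + x.1.2 * y.1.2 + x.2 * y.1.1).

Fact jet_mulA : associative jet_mul.
Proof. by move=> x y z; rewrite /jet_mul /=; congr (_, _, _); ring. Qed.
Fact jet_mulC : commutative jet_mul.
Proof. by move=> x y; rewrite /jet_mul /=; congr (_, _, _); ring. Qed.
Fact jet_mul1 : left_id ((1, 0, 0) : jet) jet_mul.
Proof. by case=> [[x y] z]; rewrite /jet_mul /=; congr (_, _, _); ring. Qed.
Fact jet_mulDl : left_distributive jet_mul +%R.
Proof. by move=> x y z; rewrite /jet_mul /=; congr (_, _, _) => /=; ring. Qed.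
Fact jet_1_neq0 : ((1, 0, 0) : jet) != 0.
Proof. by rewrite -pair_eqE /= -pair_eqE /= oner_eq0. Qed.
HB.instance Definition _ := GRing.Zmodule_isComNzRing.Build jet
  jet_mulA jet_mulC jet_mul1 jet_mulDl jet_1_neq0.

Definition jet_const (c : k) : jet := (c, 0, 0).
Fact jet_const_zmod : zmod_morphism jet_const.
Proof. by move=> x y; congr (_, _, _); rewrite /= ?subr0. Qed.
Fact jet_const_monoid : monoid_morphism jet_const.
Proof. by split=> // x y; congr (_, _, _); rewrite /= ?(mulr0, mul0r, addr0). Qed.
HB.instance Definition _ := GRing.isZmodMorphism.Build k jet jet_const jet_const_zmod.
HB.instance Definition _ := GRing.isMonoidMorphism.Build k jet jet_const jet_const_monoid.

Definition jet_dual (x : jet) : dual := x.1.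
Fact jet_dual_zmod : zmod_morphism jet_dual. Proof. by []. Qed.
Fact jet_dual_monoid : monoid_morphism jet_dual. Proof. by []. Qed.
HB.instance Definition _ := GRing.isZmodMorphism.Build jet dual jet_dual jet_dual_zmod.
HB.instance Definition _ := GRing.isMonoidMorphism.Build jet dual jet_dual jet_dual_monoid.

Definition poly_dual (p : {poly k}) : dual := (p`_0, p`_1).
Fact poly_dual_zmod : zmod_morphism poly_dual.
Proof. by move=> p q; rewrite /poly_dual !coefB. Qed.
Fact poly_dual_monoid : monoid_morphism poly_dual.
Proof.
split=> [|p q]; first by rewrite /poly_dual !coef1.
by rewrite /poly_dual !coefM !big_ord_recl !big_ord0 /= !addr0.
Qed.
HB.instance Definition _ := GRing.isZmodMorphism.Build {poly k} dual poly_dual poly_dual_zmod.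
HB.instance Definition _ :=
  GRing.isMonoidMorphism.Build {poly k} dual poly_dual poly_dual_monoid.

Definition dual_poly (x : dual) : {poly k} := x.1%:P + x.2 *: 'X.

Lemma dual_polyK : cancel dual_poly poly_dual.
Proof.
case=> x y; rewrite /poly_dual /dual_poly /= !coefD !coefC !coefZ !coefX /=.
by rewrite mulr0 mulr1 add0r addr0.
Qed.

Definition dual_const : {rmorphism k -> dual} := poly_dual \o polyC.

Lemma dual_constE c : dual_const c = (c, 0).
Proof. by rewrite /dual_const /= /poly_dual !coefC. Qed.

End TruncatedPolynomials.

Lemma poly_vanish (D : idomainType) (h : nat -> D) (p : {poly D}) :
  injective h -> (forall n, p.[h n] = 0) -> p = 0.
Proof.
move=> h_inj p0; apply/eqP/negPn/negP => p_neq0.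
pose rs := [seq h n | n <- iota 0 (size p)].
have rs_roots : all (root p) rs by apply/allP => _ /mapP[n _ ->]; apply/rootP.
have rs_uniq : uniq rs by rewrite map_inj_uniq ?iota_uniq.
by have := max_poly_roots p_neq0 rs_roots rs_uniq; rewrite size_map size_iota ltnn.
Qed.

Lemma natr_inj (k : numDomainType) : injective (fun n : nat => n%:R : k).
Proof. by move=> m n /eqP; rewrite eqr_nat => /eqP. Qed.

(** Twice the finiteness of the number of roots of a nonzero polynomial over a domain:
    first for the outer variable, at the constants n, then for the inner one. *)
Lemma bipoly_vanish (k : numFieldType) (F : {poly {poly k}}) :
  (forall x y : k, F.[x%:P].[y] = 0) -> F = 0.
Proof.
move=> F0; apply: (@poly_vanish _ (fun n => (n%:R : k)%:P)).
  by move=> m n /polyC_inj/natr_inj.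
by move=> n; apply: (@poly_vanish _ _ _ (@natr_inj k)) => m; rewrite F0.
Qed.

Definition polymap_dual (k : comNzRingType) : {rmorphism {poly {poly k}} -> {poly dual k}} :=
  map_poly (@poly_dual k).

Lemma polymap_dual_surj (k : comNzRingType) (p : {poly dual k}) :
  polymap_dual k (map_poly (@dual_poly k) p) = p.
Proof.
rewrite /polymap_dual /= -map_poly_comp_id0 ?rmorph0 // map_poly_id //.
by move=> x _ /=; rewrite dual_polyK.
Qed.

(** * Perturbing a matrix until all its maximal minors have a leading term *)

Section Perturbation.
Variable S : comNzRingType.
Implicit Types (p q : {poly S}).

Definition invertible (x : S) := exists y, x * y = 1.
Definition zero_or_invertible (x : S) := x = 0 \/ invertible x.

(** Over a ring with nilpotents, the nonzero polynomials that still have a valuation w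
    and a leading coefficient c that behave as over a field. *)
Definition monomial_like p :=
  exists w c r, invertible c /\ p = 'X^w * (c%:P + 'X * r).

Lemma invertible_neq0 x : invertible x -> x != 0.
Proof.
move=> [y xy]; apply/eqP => x0; move/eqP: xy.
by rewrite x0 mul0r eq_sym oner_eq0.
Qed.

Lemma monomial_like_coef w (c : S) (r : {poly S}) : ('X^w * (c%:P + 'X * r))`_w = c.
Proof. by rewrite coefXnM ltnn subnn coefD coefC coefXM addr0. Qed.

Lemma monomial_like_sign b p : monomial_like p -> monomial_like ((-1) ^+ b * p).
Proof.
move=> [w [c [r [[c' cc'] ->]]]]; exists w, ((-1) ^+ b * c), ((-1) ^+ b * r); split.
  by exists ((-1) ^+ b * c'); rewrite mulrACA -exprMn mulrNN mulr1 expr1n mul1r.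
rewrite mulrCA mulrDr; congr (_ * (_ + _)); last by rewrite mulrCA.
by rewrite polyCM rmorph_sign.
Qed.

Lemma monomial_likeXn D p : monomial_like p -> monomial_like ('X^D * p).
Proof.
by move=> [w [c [r [ci ->]]]]; exists (D + w)%N, c, r; rewrite mulrA exprD.
Qed.

(** As D exceeds the degree of p, either p provides the lowest term and the new terms
    come strictly above it, or p = 0 and q provides it. *)
Lemma monomial_like_perturb D p q :
  (size p <= D)%N -> p = 0 \/ monomial_like p -> q = 0 \/ monomial_like q ->
  p + 'X^D * q = 0 \/ monomial_like (p + 'X^D * q).
Proof.
move=> pD [-> | [w [c [r [ci pE]]]]] hq.
  rewrite add0r; case: hq => [-> | hq]; first by left; rewrite mulr0.
  by right; apply: monomial_likeXn.
right; have wD : (w < D)%N.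
  rewrite ltnNge; apply/negP => Dw.
  have := monomial_like_coef w c r; rewrite -pE nth_default ?(leq_trans pD) //.
  by move=> c0; have := invertible_neq0 ci; rewrite -c0 eqxx.
exists w, c, (r + 'X^(D - w.+1) * q); split=> //.
rewrite pE (_ : 'X^D = 'X^w * ('X * 'X^(D - w.+1))).
  by rewrite -mulrA -mulrDr -addrA; congr (_ * (_ + _)); rewrite mulrDr mulrA.
by rewrite -exprS -exprD -subSn ?subSS ?subnKC // ltnW.
Qed.

Lemma perturb_neq0_low D p q : (size p <= D)%N -> p != 0 -> p + 'X^D * q != 0.
Proof.
move=> pD p0; apply/eqP => /(congr1 (fun f : {poly S} => f`_(size p).-1)).
rewrite coefD coefXnM coef0 (_ : (_ < D)%N) ?addr0; last first.
  by rewrite prednK ?size_poly_gt0.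
by move/eqP; rewrite -lead_coefE lead_coef_eq0 (negPf p0).
Qed.

Lemma perturb_neq0_high D p q : (size p <= D)%N -> q != 0 -> p + 'X^D * q != 0.
Proof.
move=> pD q0; apply/eqP => /(congr1 (fun f : {poly S} => f`_(D + (size q).-1))).
rewrite coefD coefXnM coef0 ltnNge leq_addr /= addKn nth_default ?add0r; last first.
  by rewrite (leq_trans pD) ?leq_addr.
by move/eqP; rewrite -lead_coefE lead_coef_eq0 (negPf q0).
Qed.

Section Matrices.
Variables d n : nat.

Definition minor (T : comNzRingType) (B : 'M[T]_(d, n)) k
    (f : 'I_k -> 'I_d) (g : 'I_k -> 'I_n) :=
  \det (mxsub f g B).

Lemma minor_non_injective (T : comNzRingType) (B : 'M[T]_(d, n)) k (f : 'I_k -> 'I_d) g :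
  ~~ injectiveb f -> minor B f g = 0.
Proof.
move=> /injectivePn[x [y xy fxy]]; apply: (determinant_alternate xy) => z.
by rewrite !mxE fxy.
Qed.

Lemma minor_non_injective_col (T : comNzRingType) (B : 'M[T]_(d, n)) k (f : 'I_k -> 'I_d) g :
  ~~ injectiveb g -> minor B f g = 0.
Proof.
move=> /injectivePn[x [y xy fxy]]; rewrite /minor -det_tr.
apply: (determinant_alternate xy) => z.
by rewrite !mxE fxy.
Qed.

Lemma cofactor_minor (T : comNzRingType) (B : 'M[T]_(d, n)) k (f : 'I_k.+1 -> 'I_d) g x y :
  cofactor (mxsub f g B) x y =
  (-1) ^+ (x + y) * minor B (f \o lift x) (g \o lift y).
Proof.
rewrite /cofactor /minor; congr (_ * \det _).
by apply/matrixP => i j; rewrite !mxE.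
Qed.

(** Laplace expansion along the row of the modified entry: no cofactor of that row
    sees the modification. *)
Lemma minor_add_entry (T : comNzRingType) (B : 'M[T]_(d, n)) (c : T) k
    (f : 'I_k.+1 -> 'I_d) (g : 'I_k.+1 -> 'I_n) x y :
  injective f -> injective g ->
  minor (B + c *: delta_mx (f x) (g y)) f g =
  minor B f g + c * ((-1) ^+ (x + y) * minor B (f \o lift x) (g \o lift y)).
Proof.
move=> fI gI; rewrite -cofactor_minor /minor !(expand_det_row _ x).
have cofE z : cofactor (mxsub f g (B + c *: delta_mx (f x) (g y))) x z
              = cofactor (mxsub f g B) x z.
  rewrite !cofactor_minor /minor; congr (_ * \det _); apply/matrixP => a b.
  by rewrite !mxE /= (inj_eq fI) eq_sym (negPf (neq_lift _ _)) mulr0 addr0.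
under eq_bigr => z _ do rewrite cofE !mxE (inj_eq fI) eqxx (inj_eq gI) mulrDl.
rewrite big_split /=; congr (_ + _).
  by apply: eq_bigr => z _; rewrite mxE.
rewrite (bigD1 y) //= eqxx mulr1 big1 ?addr0 // => z /negPf ->.
by rewrite mulr0 mul0r.
Qed.

Lemma minor_add_entry_out (T : comNzRingType) (B : 'M[T]_(d, n)) (c : T) i j k
    (f : 'I_k -> 'I_d) (g : 'I_k -> 'I_n) :
  i \notin codom f \/ j \notin codom g ->
  minor (B + c *: delta_mx i j) f g = minor B f g.
Proof.
move=> h; congr (\det _); apply/matrixP => x y; rewrite !mxE.
case: h => h; last rewrite andbC; case: eqP => [e | _]; rewrite ?mulr0 ?addr0 //.
  by rewrite -e codom_f in h.
by rewrite -e codom_f in h.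
Qed.

(** Only finitely many minors have to be bounded, since a minor of order larger than d
    has a repeated row. *)
Lemma minor_bound (A : 'M[{poly S}]_(d, n)) :
  exists D, forall k (f : 'I_k -> 'I_d) (g : 'I_k -> 'I_n),
  (size (minor A f g) <= D)%N.
Proof.
pose F2 k f (g : {ffun 'I_k -> 'I_n}) := size (minor A (f : {ffun 'I_k -> 'I_d}) g).
pose F1 k f := \max_(g : {ffun 'I_k -> 'I_n}) F2 k f g.
pose F0 (k : 'I_d.+1) := \max_(f : {ffun 'I_k -> 'I_d}) F1 k f.
exists (\max_k F0 k) => k f g.
have [fI | fN] := boolP (injectiveb f); last by rewrite minor_non_injective // size_poly0.
have kd : (k < d.+1)%N.
  by have := leq_card _ (injectiveP _ fI); rewrite !card_ord.
apply: leq_trans (leq_bigmax (Ordinal kd)).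
apply: leq_trans (leq_bigmax (finfun f)).
apply: leq_trans (leq_bigmax (finfun g)).
rewrite /F2 (_ : minor A f g = minor A (finfun f) (finfun g)) //.
by congr (\det _); apply/matrixP => x y; rewrite !mxE !ffunE.
Qed.

(** P lists the positions to which a power of the variable has been added. The last
    clause is what makes the maximal minors nonzero in the end: it holds trivially for
    the empty P, where only the minor of order 0 is concerned, and a minor becomes
    nonzero once all the positions of one of its generalized diagonals are in P. *)
Definition perturbed (P : seq ('I_d * 'I_n)) (A0 : 'M[S]_(d, n)) (A : 'M[{poly S}]_(d, n)) :=
  [/\ map_mx (horner_eval 0) A = A0,
      forall k (f : 'I_k -> 'I_d) (g : 'I_k -> 'I_n),
        minor A f g = 0 \/ monomial_like (minor A f g) &
      forall k (f : 'I_k -> 'I_d) (g : 'I_k -> 'I_n),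
        injective f -> injective g -> (forall x, (f x, g x) \in P) ->
        minor A f g != 0].

Lemma perturbed_nil (A0 : 'M[S]_(d, n)) :
  (forall k (f : 'I_k -> 'I_d) (g : 'I_k -> 'I_n), zero_or_invertible (minor A0 f g)) ->
  perturbed [::] A0 (map_mx polyC A0).
Proof.
have mE k (f : 'I_k -> 'I_d) (g : 'I_k -> 'I_n) :
    minor (map_mx polyC A0) f g = (minor A0 f g)%:P.
  by rewrite /minor -det_map_mx; congr (\det _); apply/matrixP => x y; rewrite !mxE.
move=> A0zi; split.
- by apply/matrixP => x y; rewrite !mxE /horner_eval hornerC.
- move=> k f g; rewrite mE; have [-> | ci] := A0zi k f g; first by left.
  by right; exists 0%N, (minor A0 f g), 0; rewrite mulr0 addr0 mul1r.
- case=> [|k] f g _ _ fgP; last by have := fgP ord0.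
  by rewrite /minor det_mx00 oner_neq0.
Qed.

(** Adding 'X^D at (i, j), with D above the degrees of all minors, turns a minor m that
    involves (i, j) into m + 'X^D m', where m' is up to sign a minor of order one less;
    so no cancellation between the two terms can occur. *)
Lemma perturbed_cons ij P (A0 : 'M[S]_(d, n)) A :
  perturbed P A0 A -> exists A', perturbed (ij :: P) A0 A'.
Proof.
case: ij => i j [A_0 A_mon A_neq0]; have [D0 D0P] := minor_bound A.
pose D := D0.+1; have DP k (f : 'I_k -> 'I_d) (g : 'I_k -> 'I_n) :
  (size (minor A f g) <= D)%N by rewrite leqW.
exists (A + 'X^D *: delta_mx i j); split.
- rewrite -A_0; apply/matrixP => x y; rewrite !mxE /horner_eval hornerD hornerM.
  by rewrite hornerXn expr0n mul0r addr0.
- move=> k f g.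
  have [/injectiveP fI | fN] := boolP (injectiveb f); last by left; apply: minor_non_injective.
  have [/injectiveP gI | gN] := boolP (injectiveb g); last first.
    by left; apply: minor_non_injective_col.
  have [/codomP[x xi] | iN] := boolP (i \in codom f); last first.
    by rewrite minor_add_entry_out; [apply: A_mon | left].
  have [/codomP[y yj] | jN] := boolP (j \in codom g); last first.
    by rewrite minor_add_entry_out; [apply: A_mon | right].
  case: k f g fI gI x xi y yj => [|k] f g fI gI x xi y yj; first by case: x {xi}.
  rewrite xi yj minor_add_entry //; apply: monomial_like_perturb => //.
  have [-> | ] := A_mon k (f \o lift x) (g \o lift y); first by left; rewrite mulr0.
  by right; apply: monomial_like_sign.
- move=> k f g fI gI fgP.
  have [/codomP[x xi] | iN] := boolP (i \in codom f); last first.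
    rewrite minor_add_entry_out; last by left.
    apply: A_neq0 => // z; have := fgP z; rewrite inE => /orP[/eqP[fz _]|//].
    by rewrite -fz codom_f in iN.
  have [/codomP[y yj] | jN] := boolP (j \in codom g); last first.
    rewrite minor_add_entry_out; last by right.
    apply: A_neq0 => // z; have := fgP z; rewrite inE => /orP[/eqP[_ gz]|//].
    by rewrite -gz codom_f in jN.
  case: k f g fI gI fgP x xi y yj => [|k] f g fI gI fgP x xi y yj; first by case: x {xi}.
  rewrite xi yj minor_add_entry //; have [xy | xy] := eqVneq x y.
    apply: perturb_neq0_high => //; rewrite -signr_odd mulr_sign -xy.
    have m0 : minor A (f \o lift x) (g \o lift x) != 0.
      apply: A_neq0 => [u v /= /fI /lift_inj // | u v /= /gI /lift_inj // | z /=].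
      have := fgP (lift x z); rewrite inE => /orP[/eqP[fz _]|//].
      by move: fz; rewrite xi => /fI/eqP; rewrite eq_sym (negPf (neq_lift _ _)).
    by case: ifP; rewrite ?oppr_eq0.
  apply: perturb_neq0_low => //; apply: A_neq0 => // z.
  have := fgP z; rewrite inE => /orP[/eqP[fz gz]|//].
  by move: xy; rewrite -(fI z x) ?fz // -(gI z y) ?gz // eqxx.
Qed.

(** A special position can be left in such a way that every maximal minor acquires a
    leading term, although genericity arguments over a field do not control the
    nilpotents: perturb the entries one at a time, by powers of the variable that
    increase fast. *)
Lemma perturbation (A0 : 'M[S]_(d, n)) :
  (forall k (f : 'I_k -> 'I_d) (g : 'I_k -> 'I_n), zero_or_invertible (minor A0 f g)) ->
  exists2 A : 'M[{poly S}]_(d, n), map_mx (horner_eval 0) A = A0 &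
    forall g : 'I_d -> 'I_n, injective g -> monomial_like (\det (colsub g A)).
Proof.
move=> A0zi; have [A [A_0 A_mon A_neq0]] : exists A, perturbed (enum {: 'I_d * 'I_n}) A0 A.
  elim: (enum _) => [|ij P [A]]; last exact: perturbed_cons.
  by exists (map_mx polyC A0); apply: perturbed_nil.
exists A => // g gI; have [A0' | //] := A_mon d id g.
have := A_neq0 d id g (fun _ _ => id) gI (fun x => mem_enum _ _).
by rewrite A0' eqxx.
Qed.

End Matrices.
End Perturbation.

(** * Points of initial degenerations from one-parameter families of matrices *)

Section WeightSum.
Variables (L : finType) (wt : L -> nat).

Definition weight_sum (x : {ffun L -> int}) : int := \sum_l x l *+ wt l.

Fact weight_sum_zmod : zmod_morphism weight_sum.
Proof.
by move=> x y; rewrite /weight_sum -sumrB; apply: eq_bigr => l _; rewrite !ffunE mulrnBl.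
Qed.
HB.instance Definition _ :=
  GRing.isZmodMorphism.Build {ffun L -> int} int weight_sum weight_sum_zmod.

Lemma weight_sum_unit_exponent l : weight_sum (unit_exponent l) = wt l.
Proof.
rewrite /weight_sum (bigD1 l) //= ffunE eqxx big1 ?addr0 ?natz // => l' /negPf l'l.
by rewrite ffunE l'l mul0rn.
Qed.
End WeightSum.

Section Degeneration.
Variables (R : realType) (d n : nat) (V : zmodType).
Variable phi : {additive {ffun dset d n -> int} -> V}.
Local Notation k := R[i].
Local Notation L := (dset d n).

(** The ideals of the open Grassmannian and of the moduli space of hyperplanes are the
    cases where phi is [total_degree] and [multidegree]. *)
Definition grassmannian_ideal : set (grpalg k (kernel phi)) :=
  vanishing_ideal (torus_point (phi := phi) @` @open_grassmannian R d n)%classic.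

Lemma torus_pointE (p : {ffun L -> k}) u :
  torus_point (phi := phi) p u = monomial p (fun l => (p l)^-1) (val u).
Proof. by apply: eq_bigr => l _; rewrite zpow_exprz. Qed.

Lemma row_free_minor (A : 'M[k]_(d, n)) (g : 'I_d -> 'I_n) :
  \det (colsub g A) != 0 -> row_free A.
Proof.
move=> detA; have : row_free (colsub g A).
  by rewrite row_free_unit unitmxE unitfE.
rewrite -!row_leq_rank => /leq_trans -> //.
have -> : colsub g A = A *m colsub g 1%:M by rewrite mulmx_colsub mulmx1.
exact: mxrankM_maxl.
Qed.

(** After clearing denominators, an element of the ideal is a polynomial in the entries of
    a matrix that vanishes at the complex matrices without zero Pluecker coordinate.
    So its product with all Pluecker coordinates vanishes at all complex matrices, hence
    identically, and the extra factor cancels in the domain k[e][t], to which matrices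
    over (k[e]/(e^2))[t] lift. *)
Lemma grassmannian_ideal_vanish f (A : 'M[{poly dual k}]_(d, n)) (l0 : L) (N : nat) :
  grassmannian_ideal f ->
  (forall l : L, \det (colsub (dset_nth l) A) != 0) ->
  (forall u, u \in msupp f -> forall l, 0 <= N%:Z + val u l) ->
  \sum_(u <- msupp f) (dual_const k f@_u)%:P *
     \prod_(l : L) \det (colsub (dset_nth l) A) ^+ absz (N%:Z + val u l) = 0.
Proof.
move=> fI detA N_ge; pose At := map_mx (map_poly (@dual_poly k)) A.
pose P (l : L) := \det (colsub (dset_nth l) At).
have PE l : polymap_dual k (P l) = \det (colsub (dset_nth l) A).
  rewrite -det_map_mx; congr (\det _); apply/matrixP => i j.
  by rewrite !mxE polymap_dual_surj.
have [G GE] : exists G : {poly {poly k}}, G =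
    \sum_(u <- msupp f) (f@_u)%:P%:P * \prod_(l : L) P l ^+ absz (N%:Z + val u l).
  by eexists.
have -> : \sum_(u <- msupp f) (dual_const k f@_u)%:P *
     \prod_(l : L) \det (colsub (dset_nth l) A) ^+ absz (N%:Z + val u l) = polymap_dual k G.
  rewrite GE rmorph_sum; apply: eq_bigr => u _; rewrite rmorphM; congr (_ * _).
    by rewrite /= map_polyC.
  by rewrite rmorph_prod; apply: eq_bigr => l _; rewrite rmorphXn PE.
(* The factor makes the relation hold at the matrices with a zero minor as well. *)
suff /eqP : G * \prod_l P l = 0.
  rewrite mulf_eq0 => /orP[/eqP -> | ]; first by rewrite rmorph0.
  rewrite prodf_seq_eq0 => /hasP[l _ /eqP Pl0].
  by have := detA l; rewrite -PE Pl0 rmorph0 eqxx.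
apply: bipoly_vanish => x y.
have [ev evE] : exists ev : {rmorphism {poly {poly k}} -> k}, forall F, F.[x%:P].[y] = ev F.
  by exists (horner_eval y \o horner_eval x%:P).
rewrite evE rmorphM rmorph_prod.
pose B := map_mx ev At; pose p := pluecker B.
have evP l : ev (P l) = p l.
  rewrite ffunE -det_map_mx; congr (\det _); apply/matrixP => i j.
  by rewrite !mxE.
have [/forallP p0 | /forallPn[l]] := boolP [forall l, p l != 0]; last first.
  by rewrite negbK => /eqP pl; rewrite (bigD1 l) //= evP pl mul0r mulr0.
have Bfree : row_free B.
  by apply: (@row_free_minor _ (dset_nth l0)); have := p0 l0; rewrite ffunE.
have := fI (torus_point p) (ex_intro2 _ _ p (conj (ex_intro _ B (conj Bfree erefl)) p0) erefl).
rewrite /torus_eval => fp; rewrite GE rmorph_sum.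
rewrite (_ : \sum_(u <- _) _ = \prod_l p l ^+ N * \sum_(u <- msupp f) f@_u * torus_point p u).
  by rewrite fp mulr0 mul0r.
rewrite mulr_sumr big_seq [RHS]big_seq; apply: eq_bigr => u uf.
rewrite rmorphM mulrCA; congr (_ * _).
  by rewrite -evE !hornerC.
rewrite torus_pointE -big_split rmorph_prod; apply: eq_bigr => l _ /=.
rewrite rmorphXn evP (@zpow_shift _ _ (p l)^-1) ?divff ?N_ge //.
Qed.

Lemma exponent_bound (f : grpalg k (kernel phi)) :
  exists N : nat, forall u, u \in msupp f -> forall l, 0 <= N%:Z + val u l.
Proof.
exists (\sum_(u <- msupp f) \sum_l absz (val u l))%N => u uf l.
have z_ge0 (z : int) : 0 <= (absz z)%:Z + z by rewrite -lerBlDr sub0r abszE -normrN ler_norm.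
apply: le_trans (z_ge0 (val u l)) _.
rewrite lerD2r lez_nat (big_rem u uf) /= (bigD1 l) //=.
by rewrite -addnA leq_addr.
Qed.

Variables (A : 'M[{poly dual k}]_(d, n)) (l0 : L).
Variables (wt : L -> nat) (c c' : L -> dual k) (r : L -> {poly dual k}).
Hypothesis cc' : forall l, c l * c' l = 1.
Hypothesis minorE : forall l, \det (colsub (dset_nth l) A) = 'X^(wt l) * ((c l)%:P + 'X * r l).

(** The linear form defined by the valuations of the Pluecker coordinates of A. *)
Definition weight (u : kernel phi) : R := (weight_sum wt (val u))%:~R.

Fact weight_zmod : zmod_morphism weight.
Proof. by move=> u v; rewrite /weight !raddfB. Qed.
HB.instance Definition _ := GRing.isZmodMorphism.Build (kernel phi) R weight weight_zmod.

Let chi (u : kernel phi) := monomial c c' (val u).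

Fact point_monoid : monoid_morphism (ga_eval (dual_const k) chi).
Proof.
apply: ga_eval_is_monoid_morphism; rewrite /chi ?raddf0 ?monomial0 //.
by move=> u v; rewrite raddfD monomialD.
Qed.
HB.instance Definition _ := GRing.isMonoidMorphism.Build
  (grpalg k (kernel phi)) (dual k) (ga_eval (dual_const k) chi) point_monoid.

Lemma minor_neq0 l : \det (colsub (dset_nth l) A) != 0.
Proof.
apply/eqP => A0; have := monomial_like_coef (wt l) (c l) (r l).
rewrite -minorE A0 coef0 => cl0; have := cc' l; rewrite -cl0 mul0r => /eqP.
by rewrite eq_sym oner_eq0.
Qed.

(** The lowest coefficient in t of the relation f (minors of A) = 0 is the initial form
    of f at the leading coefficients of the minors, up to the common unit coming from
    the cleared denominators. *)
Lemma initial_form_eval f : grassmannian_ideal f ->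
  ga_eval (dual_const k) chi (initial_form weight f) = 0.
Proof.
move=> fI; have [N N_ge] := exponent_bound f.
have := grassmannian_ideal_vanish l0 fI minor_neq0 N_ge.
pose e (u : kernel phi) (l : L) := absz (N%:Z + val u l).
pose W u := (\sum_l wt l * e u l)%N.
pose Q u := \prod_l ((c l)%:P + 'X * r l) ^+ e u l.
under eq_bigr => u _.
  rewrite (_ : \prod_l _ = 'X^(W u) * Q u); last first.
    rewrite /W expr_sum -big_split; apply: eq_bigr => l _ /=.
    by rewrite minorE exprMn exprM.
  over.
move=> f0; rewrite /initial_form raddf_sum big_mkcond.
have Q0 u : u \in msupp f -> (Q u)`_0 = \prod_l c l ^+ N * chi u.
  move=> uf; rewrite -horner_coef0 horner_prod -big_split; apply: eq_bigr => l _.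
  rewrite /= horner_exp hornerD hornerC hornerM hornerX mul0r addr0.
  by rewrite /e (zpow_shift (cc' l)) ?N_ge.
have WE u : u \in msupp f -> (W u)%:Z =
    N%:Z * (\sum_l wt l)%N%:Z + weight_sum wt (val u).
  move=> uf; rewrite !(big_morph _ PoszD (erefl 0)) mulr_sumr -big_split.
  apply: eq_bigr => l _ /=; rewrite PoszM abszE ger0_norm ?N_ge //.
  by rewrite mulrDr -(mulr_natl (val u l)) natz (mulrC _ N%:Z).
have W_le u v : u \in msupp f -> v \in msupp f -> (weight u <= weight v) = (W u <= W v)%N.
  by move=> uf vf; rewrite -lez_nat !WE // lerD2l ler_int.
have [/hasP[u0 u0f /allP u0min] | /hasPn no_min] :=
    boolP (has (fun u => all (fun v => weight u <= weight v) (msupp f)) (msupp f)); last first.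
  by rewrite big_seq big1 // => u /no_min /negPf ->.
have isoN : \prod_l c l ^+ N * \prod_l c' l ^+ N = 1.
  by rewrite -big_split big1 // => l _; rewrite /= -exprMn cc' expr1n.
rewrite -[LHS]mul1r -isoN mulrAC; apply/eqP; rewrite mulrC; apply/eqP.
rewrite -[RHS](mulr0 (\prod_l c' l ^+ N)); congr (_ * _).
have /(congr1 (fun p : {poly dual k} => p`_(W u0))) := f0.
rewrite coef0 coef_sum => f0c; rewrite -[RHS]f0c mulr_sumr big_seq [RHS]big_seq.
apply: eq_bigr => u uf; rewrite coefCM coefXnM.
have le_u0u : (W u0 <= W u)%N by rewrite -W_le ?u0min.
case: ifP => [/allP umin | unmin].
  have WW : W u = W u0 by apply/eqP; rewrite eqn_leq le_u0u -W_le ?umin.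
  by rewrite WW ltnn subnn Q0 //= ga_evalU mulrCA.
rewrite ifT ?mulr0 //; rewrite ltnNge; apply/negP => le_uu0.
move/negP: unmin; apply; apply/allP => v vf.
by rewrite (le_trans _ (u0min v vf)) // W_le.
Qed.

Lemma degeneration_point :
  exists g : {rmorphism initial_degeneration grassmannian_ideal weight -> dual k},
    forall f, g (quot_pi _ f) = ga_eval (dual_const k) chi f.
Proof.
by apply: quot_ring_lift => _ [f fI <-]; apply: initial_form_eval.
Qed.

End Degeneration.

(** * Relations on initial degenerations *)

Section InitialRelation.
Variables (R : realType) (M : zmodType) (I : set (grpalg R[i] M)) (w : {additive M -> R}).
Local Notation k := R[i].
Local Notation A := (initial_degeneration I w).
Local Notation pi := (quot_pi (initial_forms I w)).

Lemma initial_form_pi0 f : I f -> pi (initial_form w f) = 0.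
Proof.
move=> fI; rewrite -(raddf0 pi); apply/quot_pi_eq; rewrite subr0.
apply/asboolP; exists [:: (1, initial_form w f)]; split; last by rewrite big_seq1 mul1r.
by move=> p; rewrite inE => /eqP -> /=; exists f.
Qed.

(** If no exponent has negative weight, the weight 0 part of a relation holds on the
    initial degeneration: it is the initial form of the relation, unless its terms cancel
    in the group algebra. *)
Lemma initial_relation (K : finType) (c : K -> k) (u : K -> M) :
  I (\sum_j << c j *g u j >>) -> (forall j, 0 <= w (u j)) ->
  \sum_(j | w (u j) == 0) pi << c j *g u j >> = 0.
Proof.
move=> fI w_ge0; set f : grpalg k M := \sum_j _ in fI.
rewrite -raddf_sum; set g : grpalg k M := \sum_(j | _) _.
have gE v : g@_v = if w v == 0 then f@_v else 0.
  rewrite /g /f !raddf_sum /= big_mkcond; case: ifP => wv0; last rewrite big1 //.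
    apply: eq_bigr => j _; case: ifP => // wj; rewrite mcoeffU.
    by case: eqP => [uv|//]; rewrite uv wv0 in wj.
  move=> j _; case: ifP => // wj; rewrite mcoeffU.
  by case: eqP => [uv|//]; rewrite uv wv0 in wj.
have supp_ge0 v : v \in msupp f -> 0 <= w v.
  rewrite -mcoeff_neq0; apply: contraR => wv; rewrite /f raddf_sum big1 //= => j _.
  rewrite mcoeffU; case: eqP => [uv|//]; have := w_ge0 j.
  by rewrite uv (negPf wv).
have [g0 | [v gv]] : g = 0 \/ exists v, g@_v != 0.
  have [g_eq0|g_neq0] := pselect (forall v, g@_v = 0).
    by left; apply/malgP => v; rewrite g_eq0 mcoeff0.
  by right; move/existsNP: g_neq0 => [v /eqP gv]; exists v.
  by rewrite g0 raddf0.
suff <- : initial_form w f = g by apply: initial_form_pi0.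
move: gv; rewrite gE; case: ifP => [/eqP wv0 fv | _]; last by rewrite eqxx.
have minE u0 : u0 \in msupp f -> all (fun v => w u0 <= w v) (msupp f) = (w u0 == 0).
  move=> u0f; apply/allP/eqP => [/(_ v) | -> v' /supp_ge0 //].
  rewrite -mcoeff_neq0 fv wv0 => /(_ isT) le0; apply/eqP.
  by rewrite eq_le le0 supp_ge0.
apply/malgP => v'; rewrite gE /initial_form raddf_sum /=.
rewrite big_seq_cond (eq_bigl (fun u0 => (u0 \in msupp f) && (w u0 == 0))); last first.
  by move=> u0; apply: andb_id2l => /minE.
under eq_bigr => u0 _ do rewrite mcoeffU.
case: (boolP (v' \in msupp f)) => v'f; last first.
  rewrite big1 ?mcoeff_outdom // ?if_same // => u0 /andP[u0f _].
  by case: eqP => [u0v|//]; rewrite -u0v u0f in v'f.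
rewrite -big_seq_cond (big_rem v' v'f) /= eqxx big_seq_cond big1 ?addr0 //.
move=> u0 /andP[]; rewrite mem_rem_uniq ?fset_uniq // inE => /andP[/negPf ne _] _.
by rewrite ne.
Qed.

Variables (T : comPzRingType) (h : {rmorphism A -> T}).

(** The values at a T-point h of the initial degeneration of the coordinates of the
    torus. *)
Definition exponential (u : M) : T := h (pi << 1 *g u >>).

Lemma exponential0 : exponential 0 = 1.
Proof. by rewrite /exponential -[<< 1 *g 0 >>]/(1 : grpalg k M) !rmorph1. Qed.

Lemma exponentialD : {morph exponential : u v / u + v >-> u * v}.
Proof.
move=> u v; rewrite /exponential -!rmorphM; congr (h (pi _)).
by rewrite -[in LHS](mul1r (1 : k)) -ga_mulUU.
Qed.

Lemma exponentialZ c u : h (pi << c *g u >>) =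
  h (initial_degeneration_map I w c) * exponential u.
Proof.
rewrite /exponential -rmorphM -[initial_degeneration_map I w c]/(pi c%:A).
rewrite -(rmorphM pi) -scalerAl mul1r; congr (h (pi _)); apply/malgP => v.
by rewrite mcoeffZ !mcoeffU mulrnAr mulr1.
Qed.

Lemma exponential_sum (J : Type) (s : seq J) (P : pred J) (F : J -> M) :
  exponential (\sum_(j <- s | P j) F j) = \prod_(j <- s | P j) exponential (F j).
Proof. exact: (big_morph _ exponentialD exponential0). Qed.

End InitialRelation.

(** * Coning a planar configuration *)

Section ConeMinors.
Variables (S : comNzRingType) (N r n : nat).

Lemma zero_or_invertible_sign b (x : S) :
  zero_or_invertible x -> zero_or_invertible ((-1) ^+ b * x).
Proof.
case=> [-> | [y xy]]; first by left; rewrite mulr0.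
by right; exists ((-1) ^+ b * y); rewrite mulrACA -exprMn mulrNN mulr1 expr1n mul1r.
Qed.

Lemma zero_or_invertible1 : zero_or_invertible (1 : S).
Proof. by right; exists 1; rewrite mulr1. Qed.

(** The block diagonal sum of V, of the identity of order r (the apexes of the cone) and of
    a zero block. Projecting from the apexes gives V back, so that the matroid of V is a
    minor of that of the cone. *)
Definition cone_matrix (V : 'M[S]_(3, N)) : 'M[S]_(3 + r, n) := \matrix_(x, j)
  match split x with
  | inl c => if insub (val j) is Some i then V c i else 0
  | inr b => (val j == N + b)%N%:R
  end.

(** A column outside those of V has at most one nonzero entry, along which the minor can be
    expanded; once only columns of V are left, a row outside those of V is zero. *)
Lemma cone_minors (V : 'M[S]_(3, N)) :
  (forall k (f : 'I_k -> 'I_3) (g : 'I_k -> 'I_N), zero_or_invertible (minor V f g)) ->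
  forall k (f : 'I_k -> 'I_(3 + r)) (g : 'I_k -> 'I_n),
    zero_or_invertible (minor (cone_matrix V) f g).
Proof.
move=> Vzi; elim=> [|k IHk] f g.
  by rewrite /minor det_mx00; apply: zero_or_invertible1.
have [/injectiveP fI | fN] := boolP (injectiveb f); last first.
  by left; apply: minor_non_injective.
have [/forallP gN | /forallPn[y]] := boolP [forall y, val (g y) < N]%N; last first.
  rewrite -leqNgt => Ny; rewrite /minor (expand_det_col _ y).
  have [[x b_x] | no_x] := pselect (exists x, cone_matrix V (f x) (g y) != 0); last first.
    left; rewrite big1 // => x _; rewrite mxE.
    have [->|ne] := eqVneq (cone_matrix V (f x) (g y)) 0; first by rewrite mul0r.
    by case: no_x; exists x.
  have entryE z : cone_matrix V (f z) (g y) = (f z == f x)%:R.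
    have big_out (c : 'I_3) : (if insub (val (g y)) is Some i then V c i else 0) = 0.
      by case: insubP => // i; rewrite ltnNge Ny.
    move: b_x; rewrite !mxE; case: splitP => [c _|b fx]; first by move: (big_out c) => -> /eqP.
    case: (val (g y) =P (N + b)%N) => [gyb _|]; last by rewrite mulr0n eqxx.
    case: splitP => [c fz|b' fz].
      rewrite (big_out c); case: eqP => // fzx; move: fz; rewrite fzx fx => /eqP.
      by rewrite eqn_leq leqNgt (leq_trans (ltn_ord c)) ?leq_addr.
    by rewrite gyb eqn_add2l -(inj_eq val_inj) /= fz fx eqn_add2l eq_sym.
  rewrite (bigD1 x) //= big1 => [|z zx]; last first.
    by rewrite mxE entryE (inj_eq fI) (negPf zx) mul0r.
  rewrite mxE entryE eqxx mul1r addr0 cofactor_minor.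
  exact: zero_or_invertible_sign.
have [/forallP f3 | /forallPn[x]] := boolP [forall x, val (f x) < 3]%N; last first.
  rewrite -leqNgt => f3; left; rewrite /minor (expand_det_row _ x) big1 // => y _.
  rewrite !mxE; case: splitP => [c fx|b fx].
    by move: f3; rewrite (fx : val _ = _) leqNgt ltn_ord.
  case: eqP => gy; last by rewrite mul0r.
  by have := gN y; rewrite gy ltnNge leq_addr.
have := Vzi _ (fun x => Ordinal (f3 x)) (fun y => Ordinal (gN y)).
rewrite /minor; congr (zero_or_invertible (\det _)); apply/matrixP => x y; rewrite !mxE.
case: splitP => [c fx|b fx]; last by exfalso; have := f3 x; rewrite (fx : val _ = _).
case: insubP => [i _ iE|]; last by rewrite gN.
by congr (V _ _); apply: val_inj.
Qed.
End ConeMinors.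

Section ConeColumns.
Variables (N r n : nat).
Hypothesis leNn : (N + r <= n)%N.

Definition base_column (i : 'I_N) : 'I_n := widen_ord leNn (lshift r i).

Definition cone_columns (t : 'I_3 -> 'I_N) (x : 'I_(3 + r)) : 'I_n :=
  match split x with
  | inl a => base_column (t a)
  | inr b => widen_ord leNn (rshift N b)
  end.

Definition increasing m m' (t : 'I_m -> 'I_m') :=
  forall a b : 'I_m, (a < b)%N -> (t a < t b)%N.

Lemma increasing_inj m m' (t : 'I_m -> 'I_m') : increasing t -> injective t.
Proof.
move=> t_inc a b tab; apply: val_inj; case: (ltngtP a b) => // /t_inc.
all: by rewrite tab ltnn.
Qed.

Lemma cone_columns_increasing t : increasing t -> increasing (cone_columns t).
Proof.
move=> t_inc x y; rewrite /cone_columns.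
case: splitP => [a ->|b ->]; case: splitP => [a' ->|b' ->] /=.
- exact: t_inc.
- by move=> _; rewrite (leq_trans (ltn_ord (t a))) ?leq_addr.
- by rewrite ltnNge ltnW // (leq_trans (ltn_ord a')) ?leq_addr.
- by rewrite !ltn_add2l.
Qed.

Lemma dset_nth_increasing d m (l : dset d m) (g : 'I_d -> 'I_m) :
  increasing g -> val l = [set g x | x : 'I_d] -> dset_nth l =1 g.
Proof.
move=> g_inc lE x.
have lt_trans : transitive (fun i j : 'I_m => i < j)%N by move=> i j k; apply: ltn_trans.
have lt_irr : irreflexive (fun i j : 'I_m => i < j)%N by move=> i; apply: ltnn.
have sorted_enum p : sorted (fun i j : 'I_p => i < j)%N (enum 'I_p).
  by have := iota_ltn_sorted 0 p; rewrite -val_enum_ord sorted_map.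
have enumE : enum (val l) = [seq g x | x <- enum 'I_d].
  apply: (irr_sorted_eq lt_trans lt_irr).
  - by rewrite /enum_mem -enumT; apply: sorted_filter (sorted_enum m).
  - by rewrite sorted_map; apply: sub_sorted (sorted_enum d) => i j; apply: g_inc.
  - move=> i; rewrite mem_enum lE; apply/imsetP/mapP => [[j _ ->]|[j _ ->]].
      by exists j; rewrite ?mem_enum.
    by exists j.
rewrite /dset_nth (enum_val_nth (g x)) enumE (nth_map x) ?size_enum_ord //=.
by rewrite nth_ord_enum.
Qed.

End ConeColumns.

Section Det3.
Variable T : comNzRingType.
Definition row0 : 'I_3 := ord0.
Definition row1 : 'I_3 := Ordinal (isT : 1 < 3)%N.
Definition row2 : 'I_3 := Ordinal (isT : 2 < 3)%N.

Lemma ord3_ind (P : 'I_3 -> Prop) : P row0 -> P row1 -> P row2 -> forall c, P c.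
Proof.
move=> P0 P1 P2 [[|[|[|//]]] p]; [move: P0 | move: P1 | move: P2]; congr P; exact: val_inj.
Qed.

Lemma det3 (A : 'M[T]_3) : \det A =
  A row0 row0 * (A row1 row1 * A row2 row2 - A row1 row2 * A row2 row1)
  - A row0 row1 * (A row1 row0 * A row2 row2 - A row1 row2 * A row2 row0)
  + A row0 row2 * (A row1 row0 * A row2 row1 - A row1 row1 * A row2 row0).
Proof.
pose b j : 'I_3 := match j with 0%N => row0 | 1%N => row1 | _ => row2 end.
have bE x : b (val x) = x by apply: val_inj; case: x => [[|[|[|]]]].
have [a AE] : exists a : nat -> nat -> T, forall x y, A x y = a (val x) (val y).
  by exists (fun x y => A (b x) (b y)) => x y; rewrite !bE.
rewrite (expand_det_row _ ord0) !big_ord_recl big_ord0 /cofactor.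
rewrite !(expand_det_row _ ord0) !big_ord_recl !big_ord0 /cofactor !det_mx11 !mxE !AE /=.
by rewrite /bump /=; ring.
Qed.
End Det3.

Section Contraction.
Variables (T : comNzRingType) (N r n : nat) (leNn : (N + r <= n)%N).

Lemma cone_columns_lshift t a : cone_columns leNn t (lshift r a) = base_column leNn (t a).
Proof. by rewrite /cone_columns -[lshift r a]/(unsplit (inl a)) unsplitK. Qed.

Lemma cone_columns_rshift t b : cone_columns leNn t (rshift 3 b) = widen_ord leNn (rshift N b).
Proof. by rewrite /cone_columns -[rshift 3 b]/(unsplit (inr b)) unsplitK. Qed.

Lemma det_cone_columns (B : 'M[T]_(3 + r, n)) t :
  (forall x b, B x (widen_ord leNn (rshift N b)) = (x == rshift 3 b)%:R) ->
  \det (colsub (cone_columns leNn t) B) =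
  \det (\matrix_(c, a) B (lshift r c) (base_column leNn (t a))).
Proof.
move=> B_apex; rewrite -(submxK (colsub _ B)).
have -> : ursubmx (colsub (cone_columns leNn t) B) = 0.
  apply/matrixP => c b; rewrite !mxE cone_columns_rshift B_apex.
  by rewrite eq_lrshift.
have -> : drsubmx (colsub (cone_columns leNn t) B) = 1%:M.
  by apply/matrixP => c b; rewrite !mxE cone_columns_rshift B_apex eq_rshift.
rewrite det_lblock det1 mulr1; congr (\det _); apply/matrixP => c a.
by rewrite !mxE cone_columns_lshift.
Qed.
End Contraction.

(** * Projective frames *)

Section Frame.
Variable m : nat.
Local Notation N := m.+4.

Definition frame (c : 'I_3) : 'I_N := widen_ord (isT : 3 <= m.+4)%N c.
Definition unit_point : 'I_N := Ordinal (isT : 3 < m.+4)%N.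

Definition triple (i j l : 'I_N) (a : 'I_3) : 'I_N :=
  match val a with 0%N => i | 1%N => j | _ => l end.

(** The frame with its point c replaced by i, sorted: by Cramer's rule, its bracket is the
    c-th coordinate of the point i up to the sign (-1) ^+ c. *)
Definition face (c : 'I_3) (i : 'I_N) : 'I_3 -> 'I_N :=
  match val c with
  | 0%N => triple (frame row1) (frame row2) i
  | 1%N => triple (frame row0) (frame row2) i
  | _ => triple (frame row0) (frame row1) i
  end.

Lemma triple_increasing (i j l : 'I_N) : (i < j < l)%N -> increasing (triple i j l).
Proof.
move=> /andP[ij jl]; elim/ord3_ind; elim/ord3_ind; rewrite /triple //= => _.
exact: ltn_trans jl.
Qed.

Lemma frame_increasing : increasing frame.
Proof. by []. Qed.

Lemma face_increasing c (i : 'I_N) : (3 <= i)%N -> increasing (face c i).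
Proof.
move=> i3; elim/ord3_ind: c; apply: triple_increasing => /=; rewrite ?andTb //.
all: exact: ltn_trans i3.
Qed.

Definition framed (T : comNzRingType) (M : 'M[T]_(3, N)) :=
  forall x c, M x (frame c) = (x == c)%:R.

Lemma det_frame (T : comNzRingType) (M : 'M[T]_(3, N)) : framed M ->
  \det (colsub frame M) = 1.
Proof.
by move=> Mf; rewrite -(det1 T 3); congr (\det _); apply/matrixP => x c; rewrite !mxE Mf.
Qed.

Lemma det_face (T : comNzRingType) (M : 'M[T]_(3, N)) c i : framed M ->
  \det (colsub (face c i) M) = (-1) ^+ (c : nat) * M c i.
Proof.
by move=> Mf; elim/ord3_ind: c; rewrite det3 !mxE /face /triple /= !Mf /=; ring.
Qed.

Lemma sum_face (V : zmodType) (tau : 'I_N -> V) c i :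
  \sum_a tau (face c i a) + tau (frame c) = tau i + \sum_a tau (frame a).
Proof.
elim/ord3_ind: c; rewrite !big_ord_recl !big_ord0 !addr0 /face /triple /=.
- have -> : lift ord0 ord0 = row1 by apply: val_inj.
  have -> : lift ord0 (lift ord0 ord0) = row2 by apply: val_inj.
  by rewrite [LHS]addrC [RHS]addrC !addrA.
- have -> : lift ord0 ord0 = row1 by apply: val_inj.
  have -> : lift ord0 (lift ord0 ord0) = row2 by apply: val_inj.
  by rewrite [RHS]addrC addrAC -!addrA; congr (_ + _); rewrite addrCA addrA.
- have -> : lift ord0 ord0 = row1 by apply: val_inj.
  have -> : lift ord0 (lift ord0 ord0) = row2 by apply: val_inj.
  by rewrite [RHS]addrC -!addrA; congr (_ + (_ + _)); rewrite addrC.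
Qed.

(** In the basis made of the columns of the frame and of the apexes, the apexes are
    coordinate vectors: the minors that contain them are the minors of order 3 of the
    remaining rows. *)
Lemma contraction (F : fieldType) r n (leNn : (N + r <= n)%N) (A : 'M[F]_(3 + r, n)) :
  \det (colsub (cone_columns leNn frame) A) != 0 ->
  exists2 M : 'M[F]_(3, N), framed M & forall t,
    \det (colsub (cone_columns leNn t) A) =
    \det (colsub (cone_columns leNn frame) A) * \det (colsub t M).
Proof.
set P := colsub _ A => P0; have Pu : P \in unitmx by rewrite unitmxE unitfE.
pose B := invmx P *m A; have PB : P *m B = A by rewrite mulKVmx.
have B1 : colsub (cone_columns leNn frame) B = 1%:M by rewrite -mulmx_colsub mulVmx.
have BE x y : B x (cone_columns leNn frame y) = (x == y)%:R.
  by have /matrixP/(_ x y) := B1; rewrite !mxE.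
exists (\matrix_(c, i) B (lshift r c) (base_column leNn i)) => [x c|t].
  by rewrite mxE -(cone_columns_lshift leNn frame c) BE eq_lshift.
rewrite -[in LHS]PB -mulmx_colsub det_mulmx (@det_cone_columns _ _ _ _ leNn B t); last first.
  by move=> x b; rewrite -(cone_columns_rshift leNn frame b) BE.
by congr (_ * \det _); apply/matrixP => c a; rewrite !mxE.
Qed.
End Frame.

(** * Normalized coordinates as torus-invariant monomials *)

Section ConeSets.
Variables (m r n : nat).
Local Notation N := m.+4.
Hypothesis leNn : (N + r <= n)%N.
Variable l0 : dset (3 + r) n.
Local Notation L := (dset (3 + r) n).

Definition cone_dset (t : 'I_3 -> 'I_N) : L :=
  insubd l0 [set cone_columns leNn t x | x : 'I_(3 + r)].

Lemma val_cone_dset t : increasing t ->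
  val (cone_dset t) = [set cone_columns leNn t x | x : 'I_(3 + r)].
Proof.
move=> /(cone_columns_increasing leNn) t_inc.
rewrite /cone_dset val_insubd card_imset ?card_ord ?eqxx //.
exact: increasing_inj.
Qed.

Lemma cone_dsetE t : increasing t -> dset_nth (cone_dset t) =1 cone_columns leNn t.
Proof.
move=> t_inc; apply: dset_nth_increasing (val_cone_dset t_inc).
exact: cone_columns_increasing.
Qed.

Lemma pluecker_cone (T : comNzRingType) (A : 'M[T]_(3 + r, n)) t : increasing t ->
  \det (colsub (dset_nth (cone_dset t)) A) = \det (colsub (cone_columns leNn t) A).
Proof.
by move=> t_inc; congr (\det _); apply/matrixP => x y; rewrite !mxE cone_dsetE.
Qed.
End ConeSets.

Section Exponents.
Variables (m : nat) (X : zmodType).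
Local Notation N := m.+4.
Variable (bracket : ('I_3 -> 'I_N) -> X) (piv : 'I_N -> 'I_3).
Hypothesis piv_frame : forall c, piv (frame m c) = c.
Local Notation frame := (frame m).
Local Notation unit_point := (unit_point m).

(** Exponent of the c-th homogeneous coordinate of the point i, in the basis given by the
    frame, up to sign. The coordinates of the frame points are constants. *)
Definition coord_exponent c (i : 'I_N) : X :=
  if (3 <= i)%N then bracket (face c i) - bracket frame else 0.

Lemma coordinateE c (i : 'I_N) : (3 <= i)%N ->
  coord_exponent c i = bracket (face c i) - bracket frame.
Proof. by rewrite /coord_exponent => ->. Qed.

Lemma coordinate_frame c (i : 'I_N) : (i < 3)%N -> coord_exponent c i = 0.
Proof. by move=> i3; rewrite /coord_exponent leqNgt i3. Qed.

(** Exponent of x_p(u) / x_p(i), where p is the pivot coordinate of i and u the unit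
    point. *)
Definition scaling_exponent (i : 'I_N) : X :=
  coord_exponent (piv i) unit_point - coord_exponent (piv i) i.

(** Exponent of (x_c(i) / x_c(u)) (x_p(u) / x_p(i)), where p is the pivot coordinate of i and
    u the unit point. This is the c-th coordinate of i in the coordinates where u is
    (1, 1, 1) and the pivot coordinate of i is 1. It does not change when the points
    or the axes are rescaled: this is why it is a character of the quotient torus. *)
Definition entry_exponent c (i : 'I_N) : X :=
  if (3 <= i)%N then
    (coord_exponent c i - coord_exponent c unit_point) + scaling_exponent i
  else 0.

Definition entry_support c (i : 'I_N) : bool := (3 <= i)%N || (c == piv i).

(** Exponent of the bracket of t, rescaled to be the determinant of the three points in
    their normalized coordinates. *)
Definition det_exponent t : X :=
  (bracket t - bracket frame) - \sum_c coord_exponent c unit_point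
  + \sum_a scaling_exponent (t a).

Lemma frameP (i : 'I_N) : (i < 3)%N -> frame (piv i) = i.
Proof.
move=> i3; have -> : i = frame (Ordinal i3) by apply: val_inj.
by rewrite piv_frame.
Qed.

(** Total degree and multidegree are both of the form phi below: a sum over the points of
    a bracket, plus the contribution sigma of the apexes. *)
Section Degree.
Variables (V : zmodType) (phi : {additive X -> V}) (sigma : V) (tau : 'I_N -> V).
Hypothesis phi_bracket : forall t, increasing t -> phi (bracket t) = sigma + \sum_a tau (t a).

Let phiB x y : phi (x - y) = phi x - phi y. Proof. exact: raddfB. Qed.
Let phiD x y : phi (x + y) = phi x + phi y. Proof. exact: raddfD. Qed.
Let phi_sum (F : 'I_3 -> X) : phi (\sum_a F a) = \sum_a phi (F a).
Proof. exact: raddf_sum. Qed.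

Lemma phi_coordinate c (i : 'I_N) : (3 <= i)%N ->
  phi (coord_exponent c i) = tau i - tau (frame c).
Proof.
move=> i3; rewrite (coordinateE _ i3) phiB.
rewrite [phi (bracket frame)](phi_bracket (@frame_increasing m)).
rewrite [phi (bracket (face c i))](phi_bracket (face_increasing c i3)).
have := sum_face tau c i => /(canRL (addrK _)) ->.
by rewrite opprD addrACA subrr add0r addrAC addrK.
Qed.

Let phi_unit c : phi (coord_exponent c unit_point) = tau unit_point - tau (frame c).
Proof. exact: phi_coordinate. Qed.

Lemma phi_scaling i : phi (scaling_exponent i) = tau unit_point - tau i.
Proof.
rewrite /scaling_exponent phiB phi_unit; case: (leqP 3 i) => i3.
  by rewrite (phi_coordinate _ i3) opprB addrA subrK.
by rewrite (coordinate_frame _ i3) raddf0 subr0 (frameP i3).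
Qed.

Lemma phi_entry c i : phi (entry_exponent c i) = 0.
Proof.
rewrite /entry_exponent; case: ifP => i3; last by rewrite raddf0.
rewrite phiD phiB phi_scaling phi_unit (phi_coordinate _ i3).
by rewrite opprB [X in X + _]addrA subrK addrA subrK subrr.
Qed.

Lemma phi_det_exponent t : increasing t -> phi (det_exponent t) = 0.
Proof.
move=> t_inc; rewrite /det_exponent phiD !phiB !phi_sum.
rewrite [phi (bracket t)](phi_bracket t_inc).
rewrite [phi (bracket frame)](phi_bracket (@frame_increasing m)).
have -> : \sum_c phi (coord_exponent c unit_point) = \sum_c (tau unit_point - tau (frame c)).
  by apply: eq_bigr => c _; apply: phi_unit.
have -> : \sum_a phi (scaling_exponent (t a)) = \sum_(a < 3) (tau unit_point - tau (t a)).
  by apply: eq_bigr => a _; apply: phi_scaling.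
rewrite !sumrB (opprD sigma) [X in X - _ + _]addrACA subrr add0r opprB [X in X + _]addrA subrK.
by rewrite addrA subrK subrr.
Qed.
End Degree.

Section Character.
Variables (T : comNzRingType) (chi : X -> T) (P0 : T) (M : 'M[T]_(3, N)).
Hypothesis chi0 : chi 0 = 1.
Hypothesis chiD : {morph chi : x y / x + y >-> x * y}.
Hypothesis Mf : framed M.
Hypothesis chi_frame : chi (bracket frame) = P0.
Hypothesis unit_coord : forall c, chi (bracket (face c unit_point)) =
  P0 * \det (colsub (face c unit_point) M).
Hypothesis piv_coord : forall i : 'I_N, (3 <= i)%N ->
  chi (bracket (face (piv i) i)) = P0 * \det (colsub (face (piv i) i) M).

Lemma chi_sub x y z : chi x = chi y * z -> chi (x - y) = z.
Proof.
by move=> xE; rewrite chiD xE mulrAC -chiD subrr chi0 mul1r.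
Qed.

Lemma chi_coordinate c (i : 'I_N) : (3 <= i)%N ->
  chi (bracket (face c i)) = P0 * \det (colsub (face c i) M) ->
  chi (coord_exponent c i) = (-1) ^+ (c : nat) * M c i.
Proof.
move=> i3 cE; rewrite (coordinateE _ i3); apply: chi_sub.
by rewrite cE chi_frame (det_face _ _ Mf).
Qed.

Lemma chi_scaling (i : 'I_N) :
  chi (scaling_exponent i) * M (piv i) i =
  (if (3 <= i)%N then 1 else (-1) ^+ (piv i : nat)) * M (piv i) unit_point.
Proof.
have chi_unit : chi (coord_exponent (piv i) unit_point) =
    (-1) ^+ (piv i : nat) * M (piv i) unit_point.
  exact: chi_coordinate.
case: (leqP 3 i) => i3.
  have chi_i := chi_coordinate i3 (piv_coord i3).
  have : chi (scaling_exponent i) * ((-1) ^+ (piv i : nat) * M (piv i) i) =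
      (-1) ^+ (piv i : nat) * M (piv i) unit_point.
    by rewrite -chi_i -chiD -chi_unit; congr chi; rewrite subrK.
  rewrite mulrCA mul1r => /(congr1 (fun x => (-1) ^+ (piv i : nat) * x)).
  by rewrite !mulrA -!exprMn mulrNN mulr1 expr1n !mul1r.
rewrite /scaling_exponent (coordinate_frame _ i3) subr0 chi_unit.
by rewrite -{4}(frameP i3) Mf eqxx mulr1.
Qed.

Lemma chi_entry c (i : 'I_N) : (3 <= i)%N ->
  chi (bracket (face c i)) = P0 * \det (colsub (face c i) M) ->
  chi (entry_exponent c i) * M c unit_point * M (piv i) i = M c i * M (piv i) unit_point.
Proof.
move=> i3 cE; have chi_i := chi_coordinate i3 cE.
have chi_unit : chi (coord_exponent c unit_point) = (-1) ^+ (c : nat) * M c unit_point.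
  exact: chi_coordinate.
have : chi (entry_exponent c i) * ((-1) ^+ (c : nat) * M c unit_point) =
    (-1) ^+ (c : nat) * M c i * chi (scaling_exponent i).
  rewrite -chi_unit -chi_i -!chiD; congr chi.
  by rewrite /entry_exponent i3 addrAC subrK.
move/(congr1 (fun x => (-1) ^+ (c : nat) * x * M (piv i) i)).
have := chi_scaling i; rewrite i3 mul1r => <-.
have : (-1) ^+ (c : nat) * (-1) ^+ (c : nat) = 1 :> T.
  by rewrite -exprMn mulrNN mulr1 expr1n.
move: ((-1) ^+ _) (chi (entry_exponent c i)) (chi (scaling_exponent i)).
move: (M c unit_point) (M (piv i) i) (M c i) => u v f a e s aa eq.
have -> : e * u * v = (a * a) * (e * u * v) by rewrite aa mul1r.
have -> : a * a * (e * u * v) = a * (e * (a * u)) * v by ring.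
by rewrite eq !mulrA aa mul1r.
Qed.
End Character.

(** The product of the signs (-1) ^+ c between coordinates and brackets: those of the
    coordinates of the unit point, and that of the pivot of each frame point among t. *)
Definition relation_sign (T : comNzRingType) (t : 'I_3 -> 'I_N) : T :=
  (\prod_(c < 3) (-1) ^+ (c : nat)) *
  \prod_a (if (3 <= t a)%N then 1 else (-1) ^+ (piv (t a) : nat)).

Lemma character_prod (T : comNzRingType) (chi : X -> T) (F : 'I_3 -> X) :
  chi 0 = 1 -> {morph chi : x y / x + y >-> x * y} ->
  chi (\sum_c F c) = \prod_c chi (F c).
Proof. by move=> chi0 chiD; apply: (big_morph chi chiD chi0). Qed.

(** The matrix of normalized coordinates of three points is obtained from that of their
    coordinates by rescaling rows and columns. Its determinant is thus the bracket of the
    three points times the factors in [det_exponent], up to the sign [relation_sign]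
    that the coordinates carry. *)
Lemma frame_relation (F : fieldType) (chi : X -> F) (P0 : F) (M : 'M[F]_(3, N)) t :
  chi 0 = 1 -> {morph chi : x y / x + y >-> x * y} -> framed M ->
  (forall t', increasing t' -> chi (bracket t') = P0 * \det (colsub t' M)) ->
  increasing t ->
  \sum_(s : 'S_3) (-1) ^+ s *
     \prod_c ((entry_support c (t (s c)))%:R * chi (entry_exponent c (t (s c)))) =
  relation_sign F t * chi (det_exponent t).
Proof.
move=> chi0 chiD Mf chiE t_inc.
have chi_neq0 x : chi x != 0.
  by apply/eqP => x0; have /eqP := chi0; rewrite -(subrr x) chiD x0 mul0r eq_sym oner_eq0.
have chi_frame : chi (bracket frame) = P0.
  by rewrite (chiE _ (@frame_increasing m)) (det_frame Mf) mulr1.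
have chi_unit c : chi (bracket (face c unit_point)) = P0 * \det (colsub (face c unit_point) M).
  by apply: chiE; apply: face_increasing.
have chi_piv (i : 'I_N) : (3 <= i)%N ->
    chi (bracket (face (piv i) i)) = P0 * \det (colsub (face (piv i) i) M).
  by move=> i3; apply: chiE; apply: face_increasing.
have M_neq0 (c : 'I_3) (i : 'I_N) : (3 <= i)%N -> M c i != 0.
  move=> i3; have := chi_neq0 (bracket (face c i)).
  by rewrite (chiE _ (face_increasing c i3)) (det_face _ _ Mf) !mulf_eq0 !negb_or => /and3P[].
have Mp_neq0 (i : 'I_N) : M (piv i) i != 0.
  case: (leqP 3 i) => i3; first exact: M_neq0.
  by rewrite -{2}(frameP i3) Mf eqxx oner_eq0.
pose alpha := \row_(c < 3) (M c unit_point)^-1.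
pose beta := \row_(a < 3) (M (piv (t a)) unit_point / M (piv (t a)) (t a)).
pose Y := \matrix_(c, a) ((entry_support c (t a))%:R * chi (entry_exponent c (t a))).
have YE : Y = diag_mx alpha *m colsub t M *m diag_mx beta.
  rewrite mul_mx_diag mul_diag_mx; apply/matrixP => c a; rewrite !mxE.
  rewrite /entry_support; case: (leqP 3 (t a)) => i3 /=.
    have cE := chiE _ (face_increasing c i3).
    have := chi_entry chi0 chiD Mf chi_frame chi_unit chi_piv i3 cE => eq.
    rewrite mul1r; apply: (mulIf (Mp_neq0 (t a))); apply: (mulIf (M_neq0 c unit_point isT)).
    rewrite mulrAC eq; have := Mp_neq0 (t a); have := M_neq0 c unit_point isT.
    by move: (M _ _) (M _ _) (M _ _) (M _ _) => x y z u x0 u0; field; rewrite x0 u0.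
  have Mi x : M x (t a) = (x == piv (t a))%:R by rewrite -{1}(frameP i3) Mf.
  rewrite /entry_exponent leqNgt i3 /= chi0 mulr1 !Mi eqxx.
  case: eqP => [->|_]; last by rewrite mulr0 mul0r.
  by rewrite mulr1 divr1 mulVf ?M_neq0.
have -> : \sum_(s : 'S_3) (-1) ^+ s *
     \prod_c ((entry_support c (t (s c)))%:R * chi (entry_exponent c (t (s c)))) = \det Y.
  by apply: eq_bigr => s _; congr (_ * _); apply: eq_bigr => c _; rewrite mxE.
rewrite YE !det_mulmx !det_diag.
pose sgn a : F := if (3 <= t a)%N then 1 else (-1) ^+ (piv (t a) : nat).
have sgn2 a : sgn a * sgn a = 1.
  by rewrite /sgn; case: ifP => _; rewrite ?mulr1 // -exprMn mulrNN mulr1 expr1n.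
have scalingE a : chi (scaling_exponent (t a)) = sgn a * beta 0 a.
  apply: (mulIf (Mp_neq0 (t a))).
  rewrite (chi_scaling chi0 chiD Mf chi_frame chi_unit chi_piv).
  by rewrite mxE -mulrA divfK.
have detE : chi (det_exponent t) * \prod_(c < 3) ((-1) ^+ (c : nat) * M c unit_point) =
    \det (colsub t M) * \prod_a (sgn a * beta 0 a).
  have -> : \prod_(c < 3) ((-1) ^+ (c : nat) * M c unit_point) =
      chi (\sum_c coord_exponent c unit_point).
    rewrite character_prod //; apply: eq_bigr => c _.
    by rewrite (chi_coordinate chi0 chiD Mf chi_frame _ (chi_unit c)).
  have -> : \prod_a (sgn a * beta 0 a) = chi (\sum_a scaling_exponent (t a)).
    by rewrite character_prod //; apply: eq_bigr => a _; rewrite scalingE.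
  have -> : \det (colsub t M) = chi (bracket t - bracket frame).
    by symmetry; apply: chi_sub => //; rewrite chiE // chi_frame.
  by rewrite -!chiD /det_exponent addrAC subrK.
have M0 : \prod_c M c unit_point != 0 by apply/prodf_neq0 => c _; apply: M_neq0.
apply: (mulIf M0).
have -> : \prod_i alpha 0 i = (\prod_c M c unit_point)^-1.
  by rewrite -prodfV; apply: eq_bigr => c _; rewrite mxE.
rewrite [LHS]mulrC !mulrA mulfV // mul1r.
rewrite /relation_sign; move: detE; rewrite !big_split /=.
have : (\prod_a sgn a) * (\prod_a sgn a) = 1 by rewrite -big_split big1 // => a _; apply: sgn2.
rewrite -[X in _ = _ * X * _ * _]/(\prod_a sgn a).
move: (chi _) (\prod_(i < 3) (-1) ^+ (i : nat)) (\prod_c M c _) (\det _).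
move: (\prod_a sgn a) (\prod_a beta 0 a) => e b x s p d ee xE.
have -> : s * e * x * p = e * (x * (s * p)) by ring.
by rewrite xE mulrCA [e * _]mulrA ee mul1r.
Qed.
End Exponents.

(** * From points of an initial degeneration to realizations *)

Section ConeMatrix.
Variables (S : comNzRingType) (N r n : nat) (leNn : (N + r <= n)%N).

Lemma cone_matrix_apex (V : 'M[S]_(3, N)) x b :
  cone_matrix r n V x (widen_ord leNn (rshift N b)) = (x == rshift 3 b)%:R.
Proof.
rewrite mxE /=; case: splitP => [c xc|b' xb].
  case: insubP => [i|_]; first by rewrite ltnNge leq_addr.
  have -> : x = lshift r c by apply: val_inj.
  by rewrite eq_lrshift.
have -> : x = rshift 3 b' by apply: val_inj.
by rewrite eqn_add2l eq_rshift eq_sym.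
Qed.

Lemma det_cone_matrix (V : 'M[S]_(3, N)) t :
  \det (colsub (cone_columns leNn t) (cone_matrix r n V)) = \det (colsub t V).
Proof.
rewrite det_cone_columns; last by move=> x b; apply: cone_matrix_apex.
congr (\det _); apply/matrixP => c a; rewrite !mxE.
rewrite -[lshift r c]/(unsplit (inl c)) unsplitK.
case: insubP => [i _ iE|]; last by rewrite /= ltn_ord.
by congr (V _ _); apply: val_inj.
Qed.
End ConeMatrix.

(** All the brackets that enter the normalizations have weight 0; so the weight of a
    normalized coordinate, or of a rescaled determinant, is that of one bracket. *)
Section Weights.
Variables (m : nat) (X Z : zmodType).
Variables (bracket : ('I_3 -> 'I_m.+4) -> X) (piv : 'I_m.+4 -> 'I_3).
Variable W : {additive X -> Z}.
Hypothesis W_frame : W (bracket (frame m)) = 0.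
Hypothesis W_unit : forall c, W (bracket (face c (unit_point m))) = 0.
Hypothesis W_piv : forall i : 'I_m.+4, (3 <= i)%N -> W (bracket (face (piv i) i)) = 0.

Lemma W_coordinate c (i : 'I_m.+4) : (3 <= i)%N ->
  W (coord_exponent bracket c i) = W (bracket (face c i)).
Proof. by move=> i3; rewrite (coordinateE _ _ i3) raddfB W_frame subr0. Qed.

Lemma W_scaling i : W (scaling_exponent bracket piv i) = 0.
Proof.
rewrite /scaling_exponent raddfB W_coordinate // W_unit sub0r; case: (leqP 3 i) => i3.
  by rewrite W_coordinate // W_piv // oppr0.
by rewrite (coordinate_frame _ _ i3) raddf0 oppr0.
Qed.

Lemma W_entry c (i : 'I_m.+4) :
  W (entry_exponent bracket piv c i) = if (3 <= i)%N then W (bracket (face c i)) else 0.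
Proof.
rewrite /entry_exponent; case: ifP => i3; last by rewrite raddf0.
by rewrite raddfD raddfB W_scaling !W_coordinate // W_unit subr0 addr0.
Qed.

Lemma W_det_exponent t : W (det_exponent bracket piv t) = W (bracket t).
Proof.
rewrite /det_exponent raddfD !raddfB W_frame subr0 !(raddf_sum W).
have -> : \sum_c W (coord_exponent bracket c (unit_point m)) = 0.
  by apply: big1 => c _; rewrite W_coordinate // W_unit.
have -> : \sum_a W (scaling_exponent bracket piv (t a)) = 0.
  by apply: big1 => a _; apply: W_scaling.
by rewrite subr0 addr0.
Qed.
End Weights.

Section TorusEval.
Variables (k : comNzRingType) (M : zmodType).
Lemma torus_eval_sum (x : M -> k) (J : finType) (c : J -> k) (u : J -> M) :
  torus_eval x (\sum_j << c j *g u j >>) = \sum_j c j * x (u j).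
Proof.
rewrite -[LHS]/(ga_eval idfun x _) raddf_sum.
by apply: eq_bigr => j _ /=; rewrite ga_evalU.
Qed.
End TorusEval.

(** The Leibniz expansion of [frame_relation], the term None being the rescaled
    determinant. *)
Lemma relation_in_grassmannian_ideal (R : realType) m r n (leNn : (m.+4 + r <= n)%N)
    (l0 : dset (3 + r) n) (V : zmodType) (phi : {additive {ffun dset (3 + r) n -> int} -> V})
    (piv : 'I_m.+4 -> 'I_3) (piv_frame : forall c, piv (frame m c) = c)
    (ek : 'I_3 -> 'I_m.+4 -> kernel phi) (uk : kernel phi) t :
  let bracket t := unit_exponent (cone_dset leNn l0 t) in
  (forall c i, val (ek c i) = entry_exponent bracket piv c i) ->
  val uk = det_exponent bracket piv t -> increasing t ->
  @grassmannian_ideal R _ _ _ phi (\sum_(j : option 'S_3)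
     << (if j is Some s then (-1) ^+ s * \prod_c (entry_support piv c (t (s c)))%:R
         else - relation_sign piv _ t)
     *g (if j is Some s then \sum_c ek c (t (s c)) else uk) >>).
Proof.
move=> bracket ekE ukE t_inc _ [p [[A [Afree pA]] p0] <-].
rewrite torus_eval_sum.
pose chi := monomial p (fun l => (p l)^-1).
have pV l : p l * (p l)^-1 = 1 by rewrite divff.
have chi0 : chi 0 = 1 by apply: monomial0.
have chiD : {morph chi : x y / x + y >-> x * y} by apply: monomialD.
have chi_bracket t' : increasing t' ->
    chi (bracket t') = \det (colsub (cone_columns leNn t') A).
  by move=> t'_inc; rewrite /chi monomial_unit_exponent pA ffunE pluecker_cone.
have P0 : \det (colsub (cone_columns leNn (frame m)) A) != 0.
  rewrite -(pluecker_cone _ l0) //.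
  by have := p0 (cone_dset leNn l0 (frame m)); rewrite pA ffunE.
have [M Mf ME] := contraction P0.
have chiE t' : increasing t' -> chi (bracket t') =
    \det (colsub (cone_columns leNn (frame m)) A) * \det (colsub t' M).
  by move=> t'_inc; rewrite chi_bracket // ME.
have := frame_relation piv_frame chi0 chiD Mf chiE t_inc.
rewrite (bigD1 None) //= => rel; rewrite torus_pointE ukE mulNr -[monomial _ _ _]/(chi _) -rel.
apply/eqP; rewrite addrC subr_eq0; apply/eqP.
rewrite (reindex_omap Some id) /=; last by case.
rewrite (eq_bigl xpredT); last by move=> s; rewrite /= eqxx.
apply: eq_bigr => s _; rewrite big_split /= mulrA; congr (_ * _).
rewrite torus_pointE -[monomial _ _ _]/(chi _) raddf_sum character_prod //.
by apply: eq_bigr => c _; rewrite -ekE.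
Qed.

Lemma grpalg_constE (k : comNzRingType) (M : zmodType) (x : k) :
  x%:A = << x *g 0 >> :> grpalg k M.
Proof.
apply/malgP => v; rewrite -[(1 : grpalg k M)]/(<< 1 *g 0 >> : grpalg k M).
by rewrite mcoeffZ !mcoeffU mulrnAr mulr1.
Qed.

Lemma entry_piv m (X : zmodType) (bracket : ('I_3 -> 'I_m.+4) -> X) piv i :
  entry_exponent bracket piv (piv i) i = 0.
Proof.
rewrite /entry_exponent; case: ifP => // _.
by rewrite /scaling_exponent addrA subrK subrr.
Qed.

Lemma entry_unit_point m (X : zmodType) (bracket : ('I_3 -> 'I_m.+4) -> X) piv c :
  entry_exponent bracket piv c (unit_point m) = 0.
Proof. by rewrite /entry_exponent /scaling_exponent !subrr addr0. Qed.

Section Realization.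
Variables (R : realType) (m r n : nat).
Local Notation k := R[i].
Local Notation N := m.+4.
Hypothesis leNn : (N + r <= n)%N.
Variable l0 : dset (3 + r) n.
Variables (V : 'M[dual k]_(3, N)) (piv : 'I_N -> 'I_3).
Hypothesis V_framed : framed V.
Hypothesis V_unit : forall c, V c (unit_point m) = 1.
Hypothesis V_minors : forall d (f : 'I_d -> 'I_3) (g : 'I_d -> 'I_N),
  zero_or_invertible (minor V f g).
Hypothesis V_piv : forall i, invertible (V (piv i) i).

Variables (Z : zmodType) (phi : {additive {ffun dset (3 + r) n -> int} -> Z}).
Variables (sigma : Z) (tau : 'I_N -> Z).
Hypothesis phi_bracket : forall t, increasing t ->
  phi (unit_exponent (cone_dset leNn l0 t)) = sigma + \sum_a tau (t a).

Lemma piv_frame c : piv (frame m c) = c.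
Proof.
apply/eqP; have := invertible_neq0 (V_piv (frame m c)).
by rewrite V_framed; case: (piv _ =P c) => // _; rewrite eqxx.
Qed.

Lemma V_entry c i : zero_or_invertible (V c i).
Proof.
have := V_minors (fun _ : 'I_1 => c) (fun _ => i).
by rewrite /minor det_mx11 mxE.
Qed.

(** The weight is the valuation of the Pluecker coordinates of a perturbation of the cone
    over V: it vanishes at the bases of V and is positive at its dependent triples. *)
Lemma degeneration_data : exists (wt : dset (3 + r) n -> nat) (c c' : dset (3 + r) n -> dual k)
    (g : {rmorphism initial_degeneration (@grassmannian_ideal R _ _ _ phi)
            (weight R (phi := phi) wt) -> dual k}),
  [/\ forall l, c l * c' l = 1,
      forall t, increasing t -> invertible (\det (colsub t V)) ->
        wt (cone_dset leNn l0 t) = 0%N /\ c (cone_dset leNn l0 t) = \det (colsub t V),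
      forall t, increasing t -> \det (colsub t V) = 0 -> (0 < wt (cone_dset leNn l0 t))%N &
      forall f, g (quot_pi _ f) = ga_eval (dual_const k) (fun u => monomial c c' (val u)) f].
Proof.
have [A A_0 A_mon] := perturbation (@cone_minors _ _ r n V V_minors).
have wit (l : dset (3 + r) n) : exists x : nat * dual k * dual k * {poly dual k},
    x.1.1.2 * x.1.2 = 1 /\
    \det (colsub (dset_nth l) A) = 'X^(x.1.1.1) * ((x.1.1.2)%:P + 'X * x.2).
  have [|w [c [q [[c' cc'] AE]]]] := A_mon (dset_nth l).
    by move=> x y /enum_val_inj/cast_ord_inj.
  by exists (w, c, c', q).
have [x xP] := choice wit.
pose wt l := (x l).1.1.1; pose c l := (x l).1.1.2; pose c' l := (x l).1.2.
have cc' l : c l * c' l = 1 by have [] := xP l.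
have minorE l : \det (colsub (dset_nth l) A) = 'X^(wt l) * ((c l)%:P + 'X * (x l).2).
  by have [] := xP l.
have [g gE] := @degeneration_point R _ _ _ phi A l0 wt c c' _ cc' minorE.
have det0 t : increasing t ->
    \det (colsub t V) = 0 ^+ wt (cone_dset leNn l0 t) * c (cone_dset leNn l0 t).
  move=> t_inc; rewrite -(det_cone_matrix leNn) -A_0.
  rewrite (_ : colsub _ _ =
    map_mx (horner_eval 0) (colsub (cone_columns leNn t) A)); last first.
    by apply/matrixP => a b; rewrite !mxE.
  rewrite det_map_mx -(pluecker_cone leNn l0 A t_inc) minorE /horner_eval.
rewrite -[LHS]/(('X^_ * (_ + 'X * _)).[0]).
  by rewrite hornerM hornerXn hornerD hornerC hornerM hornerX mul0r addr0.
exists wt, c, c', g; split=> // t t_inc.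
  move=> Di; have := invertible_neq0 Di; rewrite (det0 t t_inc).
  case: (wt _) => [|j]; first by rewrite mul1r.
  by rewrite exprS !mul0r eqxx.
move=> D0; rewrite lt0n; apply/eqP => w0; have := det0 t t_inc.
rewrite D0 w0 mul1r => c0; have := cc' (cone_dset leNn l0 t).
by rewrite -c0 mul0r => /eqP; rewrite eq_sym oner_eq0.
Qed.

(** A first-order family V of realizations of a planar matroid gives a dual number point of
    an initial degeneration; if the latter is smooth, the point lifts to second order. The
    normalized coordinates Xi of the lift again realize the matroid of V: for a dependent
    triple, the rescaled determinant has positive weight and disappears from the relation
    that expresses it by normalized coordinates, and so do the coordinates that are zero
    in V. *)
Lemma schon_realization_lift : schon (@grassmannian_ideal R _ _ _ phi) ->
  exists Xi : 'M[jet k]_(3, N),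
  [/\ forall c i, jet_dual (Xi c i) * V (piv i) i = V c i,
      forall i, Xi (piv i) i = 1, forall c, Xi c (unit_point m) = 1,
      forall c i, V c i = 0 -> Xi c i = 0 &
      forall t, increasing t -> \det (colsub t V) = 0 -> \det (colsub t Xi) = 0].
Proof.
move=> sch; have [wt [c [c' [g [cc' wt0 wt_gt0 gE]]]]] := degeneration_data.
have [h [h_beta h_lift]] : exists h : {rmorphism
    initial_degeneration (@grassmannian_ideal R _ _ _ phi)
      (weight R (phi := phi) wt) -> jet k},
    (forall x, h (initial_degeneration_map _ _ x) = jet_const x) /\
    (forall a, jet_dual (h a) = g a).
  have [_ smooth_w] := sch (weight R (phi := phi) wt).
  apply: smooth_w.
  - by move=> x; exists (x, 0).
  - move=> [[a0 a1] a2] [[b0 b1] b2] [-> ->] [-> ->].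
    by congr (_, _, _) => /=; rewrite !(mul0r, mulr0, addr0).
  - move=> x; rewrite -[initial_degeneration_map _ _ x]/(quot_pi _ (x%:A)) gE.
    rewrite grpalg_constE.
    by rewrite ga_evalU raddf0 monomial0 mulr1 dual_constE.
have [br brE] : exists br, br = fun t => unit_exponent (cone_dset leNn l0 t) by eexists.
have pf := piv_frame.
have phi_br t : increasing t -> phi (br t) = sigma + \sum_a tau (t a).
  by rewrite brE; apply: phi_bracket.
have entry_ker a i : entry_exponent br piv a i \in in_kernel phi.
  by rewrite unfold_in; apply/eqP; apply: (phi_entry pf phi_br).
have det_ker t : increasing t -> det_exponent br piv t \in in_kernel phi.
  by move=> t_inc; rewrite unfold_in; apply/eqP; apply: (phi_det_exponent pf phi_br).
pose ek a i : kernel phi := Kernel (entry_ker a i).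
have face_inv a (i : 'I_N) : invertible (V a i) -> invertible (\det (colsub (face a i) V)).
  rewrite (det_face _ _ V_framed) => -[v vE]; exists ((-1) ^+ (a : nat) * v).
  by rewrite mulrACA vE -exprMn mulrNN !mulr1 expr1n.
have one_inv : invertible (1 : dual k) by exists 1; rewrite mulr1.
have frame_inv : invertible (\det (colsub (frame m) V)) by rewrite (det_frame V_framed).
have unit_inv a : invertible (V a (unit_point m)) by rewrite V_unit.
have W_br t : weight_sum wt (br t) = wt (cone_dset leNn l0 t).
  by rewrite brE weight_sum_unit_exponent.
have W_frame : weight_sum wt (br (frame m)) = 0.
  by rewrite W_br (wt0 _ (@frame_increasing m) frame_inv).1.
have W_unit a : weight_sum wt (br (face a (unit_point m))) = 0.
  by rewrite W_br (wt0 _ _ (face_inv _ _ (unit_inv a))).1 //; apply: face_increasing.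
have W_piv (i : 'I_N) : (3 <= i)%N -> weight_sum wt (br (face (piv i) i)) = 0.
  by move=> i3; rewrite W_br (wt0 _ _ (face_inv _ _ (V_piv i))).1 //; apply: face_increasing.
have w_ek a (i : 'I_N) : weight R wt (ek a i) =
    (if (3 <= i)%N then (wt (cone_dset leNn l0 (face a i)))%:Z else 0)%:~R.
  by rewrite -W_br -(W_entry W_frame W_unit W_piv).
have w_ek_ge0 a i : 0 <= weight R wt (ek a i) by rewrite w_ek; case: ifP => _; rewrite ler0z.
have w_inv a (i : 'I_N) : invertible (V a i) -> weight R wt (ek a i) = 0.
  move=> Vi; rewrite w_ek; case: ifP => // i3.
  by rewrite (wt0 _ (face_increasing _ i3) (face_inv _ _ Vi)).1.
have w_zero a (i : 'I_N) : (3 <= i)%N -> V a i = 0 -> weight R wt (ek a i) != 0.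
  move=> i3 V0; rewrite w_ek i3 intr_eq0 -lt0n; apply: wt_gt0; first exact: face_increasing.
  by rewrite (det_face _ _ V_framed) V0 mulr0.
have V_frame a (i : 'I_N) : (i < 3)%N -> V a i = (a == piv i)%:R.
  by move=> i3; rewrite -{1}(frameP pf i3) V_framed.
pose y := exponential h.
pose Xi := \matrix_(a < 3, i < N)
  (if entry_support piv a i && (weight R wt (ek a i) == 0) then y (ek a i) else 0).
have Xi_piv i : Xi (piv i) i = 1.
  have ek0 : ek (piv i) i = 0 by apply: val_inj; apply: entry_piv.
  by rewrite mxE /entry_support eqxx orbT ek0 raddf0 eqxx; apply: exponential0.
have Xi_unit a : Xi a (unit_point m) = 1.
  have ek0 : ek a (unit_point m) = 0 by apply: val_inj; apply: entry_unit_point.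
  by rewrite mxE /entry_support ek0 raddf0 eqxx; apply: exponential0.
have Xi_zero a i : V a i = 0 -> Xi a i = 0.
  rewrite mxE /entry_support; case: (leqP 3 i) => i3 V0 /=.
    by rewrite (negPf (w_zero _ _ i3 V0)).
  have := V_frame a _ i3; rewrite V0; case: eqP => //= _ /eqP.
  by rewrite eq_sym oner_eq0.
exists Xi; split=> //.
- move=> a i; case: (V_entry a i) => [V0 | Vi].
    by rewrite (Xi_zero _ _ V0) V0 raddf0 mul0r.
  case: (leqP 3 i) => i3; last first.
    have : V a i != 0 := invertible_neq0 Vi.
    rewrite V_frame //; case: (a =P piv i) => [->|_]; last by rewrite eqxx.
    by rewrite Xi_piv rmorph1 mul1r V_frame // eqxx.
  rewrite mxE /entry_support i3 w_inv // eqxx /=.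
  have y_point (u : kernel phi) : jet_dual (y u) = monomial c c' (val u).
    by rewrite /y /exponential h_lift gE ga_evalU rmorph1 mul1r.
  rewrite y_point -[val _]/(entry_exponent br piv a i).
  have chi0 : monomial c c' 0 = 1 by apply: monomial0.
  have chiD : {morph monomial c c' : x y / x + y >-> x * y} by apply: monomialD.
  have chi_br t : increasing t -> invertible (\det (colsub t V)) ->
      monomial c c' (br t) = 1 * \det (colsub t V).
    by move=> t_inc Di; rewrite brE monomial_unit_exponent mul1r (wt0 _ t_inc Di).2.
  have chi_frame : monomial c c' (br (frame m)) = 1.
    by rewrite (chi_br _ (@frame_increasing m) frame_inv) (det_frame V_framed) mulr1.
  have chi_unit b : monomial c c' (br (face b (unit_point m))) =
      1 * \det (colsub (face b (unit_point m)) V).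
    by apply: chi_br; [apply: face_increasing | apply: face_inv].
  have chi_piv (j : 'I_N) : (3 <= j)%N -> monomial c c' (br (face (piv j) j)) =
      1 * \det (colsub (face (piv j) j) V).
    by move=> j3; apply: chi_br; [apply: face_increasing | apply: face_inv].
  have := chi_entry pf chi0 chiD V_framed chi_frame chi_unit chi_piv i3
    (chi_br _ (face_increasing a i3) (face_inv _ _ Vi)).
  by rewrite !V_unit !mulr1.
- move=> t t_inc D0; pose uk : kernel phi := Kernel (det_ker t t_inc).
  have w_uk : weight R wt uk = (wt (cone_dset leNn l0 t))%:Z%:~R.
    by rewrite -W_br -(W_det_exponent W_frame W_unit W_piv).
  have := @relation_in_grassmannian_ideal R m r n leNn l0 Z phi piv pf ek uk t.
  rewrite /= -brE => /(_ (fun _ _ => erefl) erefl t_inc) fI.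
  have u_ge0 (j : option 'S_3) : 0 <= weight R wt
      (if j is Some s then \sum_a ek a (t (s a)) else uk).
    case: j => [s|]; last by rewrite w_uk ler0z.
    by rewrite raddf_sum; apply: sumr_ge0 => a _; apply: w_ek_ge0.
  have := initial_relation fI u_ge0 => /(congr1 h).
  rewrite raddf0 raddf_sum big_mkcond (bigD1 None) //=.
  have w_uk_neq0 : (weight R wt uk == 0) = false.
    by rewrite w_uk intr_eq0; apply/negbTE; rewrite -lt0n; apply: wt_gt0.
  rewrite w_uk_neq0.
  rewrite add0r (reindex_omap Some id) /=; last by case.
  rewrite (eq_bigl xpredT); last by move=> s; rewrite /= eqxx.
  move=> <-; apply: eq_bigr => s _.
  have w_sum : weight R wt (\sum_(a < 3) ek a (t (s a))) =
      \sum_(a < 3) weight R wt (ek a (t (s a))).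
    exact: raddf_sum.
  rewrite w_sum psumr_eq0 => [|a _]; last exact: w_ek_ge0.
  case: allP => [w0 | no_w0]; last first.
    have /existsP[a wa] : [exists a, weight R wt (ek a (t (s a))) != 0].
      apply: contraT => /existsPn w0; case: no_w0 => a _.
      by apply/implyP => _; apply: (negbNE (w0 a)).
    by rewrite (bigD1 a) //= !mxE (negPf wa) andbF mul0r mulr0.
  rewrite exponentialZ h_beta exponential_sum rmorphM rmorph_sign rmorph_prod.
  rewrite -mulrA -big_split.
  congr (_ * _); apply: eq_bigr => a _; rewrite !mxE.
  have -> : weight R wt (ek a (t (s a))) == 0 := implyP (w0 a (mem_index_enum a)) isT.
  by rewrite andbT /= rmorph_nat; case: entry_support; rewrite ?mul1r ?mul0r.
Qed.
End Realization.

(** * A planar configuration with a singular realization space *)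

Section DualMap.
Variable k : comNzRingType.
Definition dual_intr (x : dual int) : dual k := (x.1%:~R, x.2%:~R).
Fact dual_intr_zmod : zmod_morphism dual_intr.
Proof. by move=> x y; rewrite /dual_intr !rmorphB. Qed.
Fact dual_intr_monoid : monoid_morphism dual_intr.
Proof.
split=> // x y; rewrite /dual_intr.
by congr pair; rewrite /= ?rmorphD !rmorphM.
Qed.
HB.instance Definition _ :=
  GRing.isZmodMorphism.Build (dual int) (dual k) dual_intr dual_intr_zmod.
HB.instance Definition _ :=
  GRing.isMonoidMorphism.Build (dual int) (dual k) dual_intr dual_intr_monoid.
End DualMap.

(** The integral dual numbers whose image in a field of characteristic 0 is zero or
    invertible. *)
Definition zero_or_nonnilpotent (x : dual int) : bool := (x.1 != 0) || (x.2 == 0).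

Lemma nonnilpotent_zero_or_invertible (k : numFieldType) x :
  zero_or_nonnilpotent x -> zero_or_invertible (dual_intr k x).
Proof.
case: x => x y; rewrite /zero_or_nonnilpotent /=.
have [-> /eqP -> | x0 _] := eqVneq x 0; first by left.
have xk : x%:~R != 0 :> k by rewrite intr_eq0.
right; exists (x%:~R^-1, - y%:~R / x%:~R ^+ 2); congr pair => /=; first exact: mulfV.
by field.
Qed.

(** The points are, in this order:
    - the coordinate points E1, E2, E3 and the unit point U;
    - O1 = (a, 1), O2 = (m, 0), (a, a), (1, a), (m, a m), (t, t), (a, a^2), (t, a^2), in the
      affine chart where the third coordinate is 1, with a = -3, m = 9 and t = -9;
    - the point at infinity in the direction (1, z), with z = a^2 / t = -1;
    - X1 = (0, y), X2 = (q, 0) and the point at infinity X3 in the direction (rho, 1), with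
      q = 3 + e, y = q / (q - 1) and rho = a - q.

    The lines through E1, E2, E3 are the horizontal lines, the vertical lines and the lines
    through the origin; they express equalities between the coordinates named above. The
    triples U X1 X2, O2 X1 X3 and O1 X2 X3 are dependent as well, which forces q to be a root
    of x^2 - (a + m) x + m, and so is (m, a m), (t, t), (1, z, 0), which forces t / a to be
    one too. *)
Definition configuration : seq (seq (dual int)) := [::
  [:: (1, 0); (0, 0); (0, 0)];
  [:: (0, 0); (1, 0); (0, 0)];
  [:: (0, 0); (0, 0); (1, 0)];
  [:: (1, 0); (1, 0); (1, 0)];
  [:: (-3%:Z, 0); (1, 0); (1, 0)];
  [:: (9%:Z, 0); (0, 0); (1, 0)];
  [:: (-3%:Z, 0); (-3%:Z, 0); (1, 0)];
  [:: (1, 0); (-3%:Z, 0); (1, 0)];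
  [:: (9%:Z, 0); (-27%:Z, 0); (1, 0)];
  [:: (-9%:Z, 0); (-9%:Z, 0); (1, 0)];
  [:: (-3%:Z, 0); (9%:Z, 0); (1, 0)];
  [:: (-9%:Z, 0); (9%:Z, 0); (1, 0)];
  [:: (1, 0); (-1, 0); (0, 0)];
  [:: (0, 0); (3%:Z, 1); (2%:Z, 1)];
  [:: (3%:Z, 1); (0, 0); (1, 0)];
  [:: (-6%:Z, -1); (1, 0); (0, 0)]].

(** For each point, a coordinate that is a unit, equal to 1 except at X1. *)
Definition pivots : seq nat := [:: 0; 1; 2; 2; 2; 2; 2; 2; 2; 2; 2; 2; 0; 2; 2; 1]%N.

Definition coord (c i : nat) : dual int := nth 0 (nth [::] configuration i) c.
Definition minor2 (c c' i j : nat) : dual int :=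
  coord c i * coord c' j - coord c j * coord c' i.
Definition minor3 (i j l : nat) : dual int :=
  coord 0 i * (coord 1 j * coord 2 l - coord 1 l * coord 2 j)
  - coord 0 j * (coord 1 i * coord 2 l - coord 1 l * coord 2 i)
  + coord 0 l * (coord 1 i * coord 2 j - coord 1 j * coord 2 i).

Lemma coord_minors1_check :
  all (fun c => all (fun i => zero_or_nonnilpotent (coord c i)) (iota 0 16)) (iota 0 3).
Proof. by vm_compute. Qed.

Lemma coord_minors2_check : all (fun c => all (fun c' => all (fun i => all (fun j =>
  zero_or_nonnilpotent (minor2 c c' i j)) (iota 0 16)) (iota 0 16)) (iota 0 3)) (iota 0 3).
Proof. by vm_compute. Qed.

Lemma coord_minors3_check : all (fun i => all (fun j => all (fun l =>
  zero_or_nonnilpotent (minor3 i j l)) (iota 0 16)) (iota 0 16)) (iota 0 16).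
Proof. by vm_compute. Qed.

Lemma pivots_check : all (fun i => (coord (nth 0%N pivots i) i).1 != 0) (iota 0 16).
Proof. by vm_compute. Qed.

Lemma det2 (T : comNzRingType) (A : 'M[T]_2) :
  \det A = A ord0 ord0 * A ord_max ord_max - A ord0 ord_max * A ord_max ord0.
Proof.
rewrite (expand_det_row _ ord0) !big_ord_recl big_ord0 /cofactor !det_mx11 !mxE /=.
have -> : lift ord0 (0 : 'I_1) = ord_max :> 'I_2 by apply: val_inj.
have -> : lift ord_max (0 : 'I_1) = ord0 :> 'I_2 by apply: val_inj.
by rewrite /=; ring.
Qed.

Section Config.
Variable k : numFieldType.

Definition config_matrix : 'M[dual k]_(3, 16) := \matrix_(c, i) dual_intr k (coord c i).
Definition config_pivot (i : 'I_16) : 'I_3 := inord (nth 0%N pivots i).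

Lemma all_iota n (P : pred nat) (i : 'I_n) : all P (iota 0 n) -> P i.
Proof. by move=> /allP; apply; rewrite mem_iota /=. Qed.

Lemma config_minor2 (c c' : 'I_3) (i j : 'I_16) : zero_or_nonnilpotent (minor2 c c' i j).
Proof. exact: (all_iota j (all_iota i (all_iota c' (all_iota c coord_minors2_check)))). Qed.

Lemma config_minor3 (i j l : 'I_16) : zero_or_nonnilpotent (minor3 i j l).
Proof. exact: (all_iota l (all_iota j (all_iota i coord_minors3_check))). Qed.

Lemma config_det t :
  \det (colsub t config_matrix) = dual_intr k (minor3 (t row0) (t row1) (t row2)).
Proof. by rewrite det3 !mxE /minor3 rmorphD rmorphB !rmorphM !rmorphB !rmorphM. Qed.

Lemma config_minors d (f : 'I_d -> 'I_3) (g : 'I_d -> 'I_16) :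
  zero_or_invertible (minor config_matrix f g).
Proof.
have [/injectiveP f_inj | fN] := boolP (injectiveb f); last first.
  by left; apply: minor_non_injective.
case: d f g f_inj => [|[|[|[|d]]]] f g f_inj.
- by rewrite /minor det_mx00; apply: zero_or_invertible1.
- rewrite /minor det_mx11 !mxE; apply: nonnilpotent_zero_or_invertible.
  exact: (all_iota _ (all_iota _ coord_minors1_check)).
- rewrite /minor det2 !mxE -!rmorphM -rmorphB; apply: nonnilpotent_zero_or_invertible.
  exact: config_minor2.
(* The checks cover all choices of three columns, but the rows in their order only. *)
- pose s := perm f_inj.
  have -> : minor config_matrix f g = (-1) ^+ s * \det (colsub g config_matrix).
    rewrite -det_perm -det_mulmx -row_permE; congr (\det _); apply/matrixP => x y.
    by rewrite !mxE permE.
  apply: zero_or_invertible_sign; rewrite config_det; apply: nonnilpotent_zero_or_invertible.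
  exact: config_minor3.
- have := leq_card _ f_inj; rewrite !card_ord //.
Qed.

Lemma config_framed : framed (m := 12) config_matrix.
Proof.
by elim/ord3_ind; elim/ord3_ind; rewrite mxE; congr pair.
Qed.

Lemma config_unit c : config_matrix c (unit_point 12) = 1.
Proof. by elim/ord3_ind: c; rewrite mxE. Qed.

Lemma config_pivot_invertible i : invertible (config_matrix (config_pivot i) i).
Proof.
rewrite mxE inordK; last first.
  by apply: (all_iota (P := fun i => (nth 0%N pivots i < 3)%N)).
have /= := all_iota i pivots_check; set x := coord _ _ => x0.
have [] := @nonnilpotent_zero_or_invertible k x; first by rewrite /zero_or_nonnilpotent x0.
  by case=> /eqP; rewrite intr_eq0 (negPf x0).
by [].
Qed.
End Config.

Lemma eq_by_relation (T : comNzRingType) (E x y c : T) : E = 0 -> x - y = c * E -> x = y.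
Proof. by move=> ->; rewrite mulr0 => /eqP; rewrite subr_eq0 => /eqP. Qed.

(** At a = -3, m = 9 the quadratic x^2 - (a + m) x + m has the double root 3 = t / a, whereas
    q = 3 + e: both factors are -3 e modulo e^2, so that the product is 9 e^2. *)
Lemma jet_not_zero (k : numFieldType) (a m q t : jet k) :
  jet_dual a = dual_intr k (-3%:Z, 0) -> jet_dual m = dual_intr k (9%:Z, 0) ->
  jet_dual q = dual_intr k (3%:Z, 1) -> jet_dual t = dual_intr k (-9%:Z, 0) ->
  (a * q - t) * (a * q + t - a * (a + m)) != 0.
Proof.
case: a m q t => [[a0 a1] a2] [[m0 m1] m2] [[q0 q1] q2] [[t0 t1] t2].
move=> [-> ->] [-> ->] [-> ->] [-> ->].
set x : jet k := _ * _; have -> : x = (0, 0, 9).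
  by rewrite /x; congr (_, _, _) => /=; ring.
by apply/eqP => -[/eqP]; rewrite pnatr_eq0.
Qed.

(** Both q and t / a are roots of x^2 - (a + m) x + m. *)
Lemma two_roots (T : comNzRingType) (a m q t z y rho : T) :
  t * z = a * a -> z * (t - m) = t - a * m -> y * (q - 1) = q -> y * rho + m = 0 ->
  rho = a - q -> (a * q - t) * (a * q + t - a * (a + m)) = 0.
Proof.
move=> tz zE yq yrho rhoE.
have F : q * (a - q) + m * (q - 1) = 0.
  by rewrite -rhoE -{1}yq; transitivity ((q - 1) * (y * rho + m)); [ring | rewrite yrho mulr0].
have G : a * a * (t - m) = t * (t - a * m) by rewrite -tz -zE; ring.
(* a^2 (q^2 - (a + m) q + m) - (t^2 - a (a + m) t + a^2 m), a difference of two quadratics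
   with the same coefficients in a q and t, factors. *)
transitivity (a * a * (t - m) - t * (t - a * m)
  - a * a * (q * (a - q) + m * (q - 1))); first ring.
by rewrite G F; ring.
Qed.

(** The dependent triples determine all the coordinates of Xi from a, m, q and t, and leave
    the equation of [two_roots], which [jet_not_zero] excludes. *)
Lemma config_no_jet_lift (k : numFieldType) (Xi : 'M[jet k]_(3, 16)) :
  [/\ forall c i, jet_dual (Xi c i) * config_matrix k (config_pivot i) i = config_matrix k c i,
      forall i, Xi (config_pivot i) i = 1, forall c, Xi c (unit_point 12) = 1,
      forall c i, config_matrix k c i = 0 -> Xi c i = 0 &
      forall t, increasing t -> \det (colsub t (config_matrix k)) = 0 ->
        \det (colsub t Xi) = 0] ->
  False.
Proof.
move=> [Xi_lift Xi_piv Xi_unit Xi_zero Xi_det].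
pose X c i := Xi c (inord i).
have matE (c : 'I_3) i : (i < 16)%N -> config_matrix k c (inord i) = dual_intr k (coord c i).
  by move=> i16; rewrite mxE inordK.
have config_pivotE (c : 'I_3) i : (i < 16)%N -> nth 0%N pivots i = c ->
    config_pivot (inord i) = c.
  by move=> i16 ic; rewrite /config_pivot inordK // ic inord_val.
have pivE (c : 'I_3) i : (i < 16)%N -> nth 0%N pivots i = c -> X c i = 1.
  by move=> i16 ic; rewrite /X -[RHS](Xi_piv (inord i)) (config_pivotE c).
have zeroE (c : 'I_3) i : (i < 16)%N -> coord c i = 0 -> X c i = 0.
  by move=> i16 ci; apply: Xi_zero; rewrite matE // ci rmorph0.
have liftE (c p : 'I_3) i : (i < 16)%N -> nth 0%N pivots i = p -> coord p i = 1 ->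
    jet_dual (X c i) = dual_intr k (coord c i).
  move=> i16 ip pi1; rewrite -(matE c i i16) -Xi_lift.
  by rewrite (config_pivotE p) // matE // pi1 rmorph1 mulr1.
have unitE c : X c 3 = 1.
  by rewrite -(Xi_unit c) /X; congr (Xi c _); apply: val_inj; rewrite /= inordK.
have rel i j l : (i < j < l)%N -> (l < 16)%N -> minor3 i j l = 0 ->
    X row0 i * (X row1 j * X row2 l - X row1 l * X row2 j)
    - X row0 j * (X row1 i * X row2 l - X row1 l * X row2 i)
    + X row0 l * (X row1 i * X row2 j - X row1 j * X row2 i) = 0.
  move=> /andP[ij jl] l16 ijl0.
  have j16 := ltn_trans jl l16; have i16 := ltn_trans ij j16.
  pose t : 'I_3 -> 'I_16 := triple (m := 12) (inord i) (inord j) (inord l).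
  have t_inc : increasing t by apply: triple_increasing; rewrite !inordK ?ij.
  have := Xi_det t t_inc.
  rewrite config_det /t /triple /= !inordK // ijl0 rmorph0 => /(_ erefl).
  rewrite det3 !mxE /triple /= -!/(X _ _) => <-; ring.
set a := X row0 4; set m := X row0 5; set q := X row0 14; set t := X row0 9.
set z := X row1 12.
set y := X row1 13; set rho := X row0 15.
have E0 : (X row0 0 = 1) * (X row1 0 = 0) * (X row2 0 = 0).
  by split; [split|]; [apply: pivE | apply: zeroE | apply: zeroE].
have E1 : (X row0 1 = 0) * (X row1 1 = 1) * (X row2 1 = 0).
  by split; [split|]; [apply: zeroE | apply: pivE | apply: zeroE].
have E2 : (X row0 2 = 0) * (X row1 2 = 0) * (X row2 2 = 1).
  by split; [split|]; [apply: zeroE | apply: zeroE | apply: pivE].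
have z1 i : (i < 16)%N -> nth 0%N pivots i = 2%N -> X row2 i = 1 by move=> i16 ip; apply: pivE.
have o1 : X row1 4 = 1.
  have := rel 0%N 3%N 4%N isT isT erefl; rewrite !E0 !unitE (z1 4) // => H.
  by apply: (eq_by_relation (c := -1) H); ring.
have Y0 : X row0 6 = a.
  have := rel 1%N 4%N 6%N isT isT erefl; rewrite !E1 (z1 4) // (z1 6) // => H.
  by apply: (eq_by_relation (c := 1) H); rewrite /a; ring.
have Y1 : X row1 6 = a.
  have := rel 2%N 3%N 6%N isT isT erefl; rewrite !E2 !unitE (z1 6) // Y0 => H.
  by apply: (eq_by_relation (c := 1) H); rewrite /a; ring.
have A0 : X row0 7 = 1.
  have := rel 1%N 3%N 7%N isT isT erefl; rewrite !E1 !unitE (z1 7) // => H.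
  by apply: (eq_by_relation (c := 1) H); ring.
have A1 : X row1 7 = a.
  have := rel 0%N 6%N 7%N isT isT erefl; rewrite !E0 (z1 6) // (z1 7) // Y1 => H.
  by apply: (eq_by_relation (c := -1) H); ring.
have S0 : X row0 8 = m.
  have := rel 1%N 5%N 8%N isT isT erefl; rewrite !E1 (z1 5) // (z1 8) // => H.
  by apply: (eq_by_relation (c := 1) H); rewrite /m; ring.
have S1 : X row1 8 = a * m.
  have := rel 2%N 7%N 8%N isT isT erefl; rewrite !E2 A0 A1 S0 => H.
  by apply: (eq_by_relation (c := 1) H); ring.
have T1 : X row1 9 = t.
  have := rel 2%N 3%N 9%N isT isT erefl; rewrite !E2 !unitE => H.
  by apply: (eq_by_relation (c := 1) H); rewrite /t; ring.
have D0 : X row0 10 = a.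
  have := rel 1%N 4%N 10%N isT isT erefl; rewrite !E1 (z1 4) // (z1 10) // => H.
  by apply: (eq_by_relation (c := 1) H); rewrite /a; ring.
have D1 : X row1 10 = a * a.
  have := rel 2%N 7%N 10%N isT isT erefl; rewrite !E2 A0 A1 D0 => H.
  by apply: (eq_by_relation (c := 1) H); ring.
have P0 : X row0 11 = t.
  have := rel 1%N 9%N 11%N isT isT erefl; rewrite !E1 (z1 9) // (z1 11) // => H.
  by apply: (eq_by_relation (c := 1) H); rewrite /t; ring.
have P1 : X row1 11 = a * a.
  have := rel 0%N 10%N 11%N isT isT erefl; rewrite !E0 (z1 10) // (z1 11) // D1 => H.
  by apply: (eq_by_relation (c := -1) H); ring.
have Z0 : (X row0 12 = 1) * (X row2 12 = 0) by split; [apply: pivE | apply: zeroE].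
have tz : t * z = a * a.
  have := rel 2%N 11%N 12%N isT isT erefl; rewrite !E2 P0 P1 !Z0 => H.
  by apply: (eq_by_relation (c := 1) H); rewrite /z; ring.
have zE : z * (t - m) = t - a * m.
  have := rel 8%N 9%N 12%N isT isT erefl; rewrite S0 S1 T1 (z1 8) // (z1 9) // !Z0 => H.
  by apply: (eq_by_relation (c := 1) H); rewrite /z /t; ring.
have x1 : X row0 13 = 0 by apply: zeroE.
have x2 : X row1 14 = 0 by apply: zeroE.
have x3 : (X row1 15 = 1) * (X row2 15 = 0) by split; [apply: pivE | apply: zeroE].
have m1 : X row1 5 = 0 by apply: zeroE.
have yq : y * (q - 1) = q.
  have := rel 3%N 13%N 14%N isT isT erefl; rewrite !unitE x1 x2 (z1 13) // (z1 14) // => H.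
  by apply: (eq_by_relation (c := -1) H); rewrite /y /q; ring.
have yrho : y * rho + m = 0.
  have := rel 5%N 13%N 15%N isT isT erefl; rewrite m1 x1 !x3 (z1 5) // (z1 13) // => H.
  by apply: (eq_by_relation (c := -1) H); rewrite /y /rho /m; ring.
have rhoE : rho = a - q.
  have := rel 4%N 14%N 15%N isT isT erefl; rewrite o1 x2 !x3 (z1 4) // (z1 14) // => H.
  by apply: (eq_by_relation (c := 1) H); rewrite /rho /a /q; ring.
have /eqP := two_roots tz zE yq yrho rhoE; apply/negP/jet_not_zero.
- exact: (liftE row0 row2 4).
- exact: (liftE row0 row2 5).
- exact: (liftE row0 row2 14).
- exact: (liftE row0 row2 9).
Qed.

Section Lattices.
Variables (m r n : nat) (leNn : (m.+4 + r <= n)%N) (l0 : dset (3 + r) n).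

Lemma total_degree_cone_dset t : increasing t ->
  total_degree (unit_exponent (cone_dset leNn l0 t)) = 1 + \sum_(a < 3) 0.
Proof.
move=> _; rewrite big1 // addr0 /total_degree (bigD1 (cone_dset leNn l0 t)) //= ffunE eqxx.
by rewrite big1 ?addr0 // => l /negPf ne; rewrite ffunE ne.
Qed.

Lemma multidegree_cone_dset t : increasing t ->
  multidegree (unit_exponent (cone_dset leNn l0 t)) =
  \sum_(b < r) std_basis (widen_ord leNn (rshift m.+4 b)) +
  \sum_(a < 3) std_basis (base_column leNn (t a)).
Proof.
move=> t_inc; rewrite /multidegree (bigD1 (cone_dset leNn l0 t)) //= ffunE eqxx.
rewrite [X in _ + X]big1 ?addr0 => [|l /negPf ne]; last by rewrite ffunE ne.
rewrite (val_cone_dset leNn l0 t_inc) big_imset /=; last first.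
  by move=> x x' _ _; apply: increasing_inj; apply: cone_columns_increasing.
rewrite (eq_bigl xpredT) // big_split_ord mulr1z [RHS]addrC /=.
congr (_ + _); apply: eq_bigr => x _; first by rewrite cone_columns_lshift.
by rewrite cone_columns_rshift.
Qed.
End Lattices.

Lemma cone_not_schon (R : realType) r n (leNn : (16 + r <= n)%N) (l0 : dset (3 + r) n)
    (Z : zmodType) (phi : {additive {ffun dset (3 + r) n -> int} -> Z})
    (sigma : Z) (tau : 'I_16 -> Z) :
  (forall t : 'I_3 -> 'I_16, increasing t ->
    phi (unit_exponent (cone_dset (m := 12) leNn l0 t)) = sigma + \sum_a tau (t a)) ->
  ~ schon (@grassmannian_ideal R _ _ _ phi).
Proof.
move=> phiE sch.
have [Xi XiP] := schon_realization_lift (m := 12) (@config_framed _) (@config_unit _)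
  (@config_minors _) (@config_pivot_invertible _) phiE sch.
exact: (config_no_jet_lift XiP).
Qed.

Local Close Scope ring_scope.

Theorem theorem1p4 (R : realType) :
  exists exceptions : seq (nat * nat),
    forall d n : nat, 3 <= d -> d.*2 <= n -> (d, n) \notin exceptions ->
      ~ schon (open_grassmannian_ideal R d n) /\
      ~ schon (moduli_hyperplanes_ideal R d n).
Proof.
(* If 26 <= n then 13 <= n - d, because d <= n / 2: the d - 3 apexes leave room for the 16
   points. *)
exists [seq (d, n) | d <- iota 0 26, n <- iota 0 26].
case=> [|[|[|r]]] // n _ dn small.
have leNn : (16 + r <= n)%N.
  have [n26 | n26] := ltnP n 26; last by move: dn n26; rewrite -addnn; lia.
  case/negP: small; apply/allpairsP; exists (r.+3, n).
  by split=> //; rewrite mem_iota //=; move: dn; rewrite -addnn; lia.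
have card_l0 : #|[set cone_columns leNn (frame 12) x | x : 'I_(3 + r)]| == (3 + r)%N.
  rewrite card_imset ?card_ord //; apply: increasing_inj.
  exact: cone_columns_increasing.
pose l0 : dset (3 + r) n := exist (fun l : {set 'I_n} => #|l| == 3 + r) _ card_l0.
split.
- apply: (@cone_not_schon R r n leNn l0 _ (@total_degree (3 + r) n) 1%R (fun => 0%R)).
  exact: total_degree_cone_dset.
- apply: (@cone_not_schon R r n leNn l0 _ (@multidegree (3 + r) n) _
    (fun i => std_basis (base_column leNn i))).
  exact: multidegree_cone_dset.
Qed.
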